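(* Let $B$ be a nilpotent constant $n\times n$ matrix and let $r\ge2$ be a natural number such that $B^r=0$. Then the system $\nabla f=B\nabla g$ can be extended to the system $$A_\mu\nabla V_\mu\equiv0\pmod{\mu^r},$$ where $$A_\mu=-B+\mu I,\qquad V_\mu=V_0+\mu V_1+\cdots+\mu^{r-3}V_{r-3}+\mu^{r-2}f+\mu^{r-1}g .$$ That is: if $V_\mu$ is a solution of the latter system then $(f,g)$ is a solution of $\nabla f=B\nabla g$; and for every solution $(f,g)$ of $\nabla f=B\nabla g$ there exist auxiliary functions $V_0,\dots,V_{r-3}$, uniquely determined up to additive constants by $(f,g)$, such that $V_\mu$ is a solution of $A_\mu\nabla V_\mu\equiv0\pmod{\mu^r}$.
   Context: All functions are scalar-valued and smooth (analytic in the complex case) on an open convex domain of an $n$-dimensional vector space over $\mathbb R$ or $\mathbb C$ (with $B$ having entries in the same field); $\nabla$ is the column vector of partial derivatives with respect to linear coordinates. $\mu$ is a formal parameter, and $A_\mu\nabla V_\mu\equiv0\pmod{\mu^r}$ means that every component of $A_\mu\nabla V_\mu$, as a polynomial in $\mu$, is divisible by $\mu^r$. *)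

(* Defs.v *)
From HB Require Import structures.
From mathcomp Require Import all_boot all_order all_algebra finmap.
From mathcomp Require Import complex.
From mathcomp Require Import all_classical all_reals all_analysis.

Set Implicit Arguments.
Unset Strict Implicit.
Unset Printing Implicit Defensive.

Import Order.TTheory GRing.Theory Num.Theory.
Import numFieldNormedType.Exports.

Local Open Scope classical_set_scope.
Local Open Scope ring_scope.

(* The filter of large finite subsets: convergence along it of the finite
   partial sums is unconditional (for K = C, absolute) convergence. *)
Definition finite_subsets {I : choiceType} : set_system {fset I} :=
  filter_from setT (fun A : {fset I} => [set A' : {fset I} | (A `<=` A')%fset]).

#[global] Instance finite_subsets_filter (I : choiceType) :
  ProperFilter (@finite_subsets I).
Proof.
apply: filter_from_proper => [|A _]; last by exists A => /=.
apply: filter_from_filter; first by exists fset0.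
move=> A A' _ _; exists (A `|` A')%fset => // C /=.
by rewrite fsubUset => /andP[].
Qed.

Section Calculus.
Context {K : numFieldType} {n : nat}.
Implicit Types (f g : 'cV[K]_n -> K) (D : set 'cV[K]_n).

Definition partial (i : 'I_n) f : 'cV[K]_n -> K :=
  fun x => 'D_(delta_mx i 0) f x.

Definition grad f (x : 'cV[K]_n) : 'cV[K]_n := \col_i partial i f x.

Definition iter_partial (s : seq 'I_n) f : 'cV[K]_n -> K :=
  foldr partial f s.

(* C^infinity on D: the iterated partial derivatives of every order exist and
   are continuous. The derivatives are taken in the ambient space, so this is
   the usual notion only when D is open. *)
Definition smooth_on D f := forall (s : seq 'I_n) (x : 'cV[K]_n), D x ->
  {for x, continuous (iter_partial s f)} /\
  forall i, derivable (iter_partial s f) x (delta_mx i 0).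

Definition monom (h : 'cV[K]_n) (m : {ffun 'I_n -> nat}) : K :=
  \prod_i h i 0 ^+ m i.

Definition analytic_at f (a : 'cV[K]_n) :=
  exists c : {ffun 'I_n -> nat} -> K, \forall h \near (0 : 'cV[K]_n),
    (fun A : {fset {ffun 'I_n -> nat}} => \sum_(m <- A) c m * monom h m)
    @ finite_subsets --> f (a + h).

Definition analytic_on D f := forall a, D a -> analytic_at f a.

End Calculus.

Variant ground := RealCase | ComplexCase.

Definition scalars (R : realType) (c : ground) : numFieldType :=
  match c with
  | RealCase => R
  | ComplexCase => R[i]
  end.

Definition regular_on (R : realType) (c : ground) (n : nat) :
    set 'cV[scalars R c]_n -> ('cV[scalars R c]_n -> scalars R c) -> Prop :=
  match c with
  | RealCase => smooth_on
  | ComplexCase => analytic_on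
  end.

(* The formal parameter mu is the indeterminate 'X of {poly K}. *)
Section System.
Context {K : numFieldType} {n : nat}.
Implicit Types (f g : 'cV[K]_n -> K) (B : 'M[K]_n).

Definition nilpotent_mx B := exists k : nat, B ^+ k = 0.

Definition A_mu B : 'M[{poly K}]_n := - map_mx polyC B + 'X%:M.

Definition V_mu (r : nat) (V : 'I_(r - 2) -> 'cV[K]_n -> K) f g
    (x : 'cV[K]_n) : {poly K} :=
  \sum_(k < r - 2) V k x *: 'X^k + f x *: 'X^(r - 2) + g x *: 'X^(r - 1).

(* The gradient acts on the coefficients of the powers of mu; d bounds the
   number of coefficients (for V_mu r V f g, take d = r). *)
Definition grad_mu (d : nat) (W : 'cV[K]_n -> {poly K}) (x : 'cV[K]_n) :
    'cV[{poly K}]_n :=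
  \col_i \poly_(k < d) partial i (fun y => (W y)`_k) x.

End System.

Section Solutions.
Context {R : realType} {c : ground} {n : nat}.
Local Notation K := (scalars R c).
Implicit Types (D : set 'cV[K]_n) (B : 'M[K]_n) (f g : 'cV[K]_n -> K).

Definition gradient_solution D B f g :=
  [/\ regular_on D f, regular_on D g
    & forall x, D x -> grad f x = B *m grad g x].

Definition extended_solution (r : nat) D B
    (V : 'I_(r - 2) -> 'cV[K]_n -> K) f g :=
  [/\ forall k, regular_on D (V k), regular_on D f, regular_on D g
    & forall x, D x -> forall i,
        'X^r %| (A_mu B *m grad_mu r (V_mu V f g) x) i 0].

End Solutions.

(* Main.v *)
Require Import Defs.
From HB Require Import structures.
From mathcomp Require Import all_boot all_order all_algebra finmap.
From mathcomp Require Import complex.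
From mathcomp Require Import all_classical all_reals all_analysis.
From mathcomp Require Import ring lra.

Set Implicit Arguments.
Unset Strict Implicit.
Unset Printing Implicit Defensive.

Import Order.TTheory GRing.Theory Num.Theory.
Import numFieldNormedType.Exports.

Local Open Scope classical_set_scope.
Local Open Scope ring_scope.

(** Comparing coefficients of powers of mu, the extended system says that the
    coefficients V_0, ..., V_(r-1) of V_mu (so V_(r-2) = f and V_(r-1) = g)
    satisfy B grad V_0 = 0 and grad V_k = B grad V_(k+1) for k + 1 < r
    ([A_mu_grad_muP]).  Its last equation is grad f = B grad g.  Conversely the
    chain forces grad V_k = B^(r-1-k) grad g, which determines every V_k up to a
    constant, and makes the equation B grad V_0 = B^r grad g = 0 automatic.  So
    everything reduces to one integration step: if grad f = B grad g then the
    field B grad f has a regular primitive h ([gradient_solution_next]); the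
    pair (h, f) then satisfies the same hypothesis and the step is iterated.

    The field B grad f is closed because, for the Hessian H of g, the derivative
    of f gives B H = H B^T, hence the Jacobian of B grad f is B B H = B H B^T,
    which is symmetric.  On a convex domain a closed field is a gradient.  Real
    and complex domains share the passage from local to global: two primitives on
    a convex open set differ by a constant ([same_gradient]), so that primitives
    found near each point can be continued along segments from a base point and
    patched ([glue_gradient]).  The only tool is a mean value inequality along
    segments ([mean_value_ineq]), proved for any scalar field containing the
    reals by subdividing the unit interval.

    Only the local primitives depend on the field.  For smooth real fields the
    integral of F along the ray from the centre is differentiated by means of
    second-order Taylor bounds, which are uniform near the centre because second
    derivatives are locally bounded ([local_primitive_real]).  For analytic fields
    the power series is integrated coefficient by coefficient; this rests on
    termwise differentiation ([has_expansion_derive]), which also yields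
    uniqueness of the coefficients, so that closedness becomes an identity between
    coefficients ([analytic_local_primitive]).  The global primitive is analytic
    since near each point it differs by a constant from such a series. *)

(** * The mean value inequality *)

(** Cousin's lemma for the unit interval: the supremum of the points t for which
    Q 0 t holds belongs to that set and cannot be smaller than 1.  It turns local
    statements along a segment into global ones without integration. *)
Lemma cousin_01 (R : realType) (Q : R -> R -> Prop) :
    (forall u v w, u <= v -> v <= w -> Q u v -> Q v w -> Q u w) ->
    (forall t, 0 <= t <= 1 -> exists2 d, 0 < d & forall u v,
       0 <= u -> t - d < u -> u <= t -> t <= v -> v < t + d -> v <= 1 ->
       Q u v) ->
  Q 0 1.
Proof.
move=> Qtrans Qloc.
have Qrefl t : 0 <= t <= 1 -> Q t t.
  move=> t01; have [d d0] := Qloc t t01.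
  by case/andP: t01 => t0 t1; apply => //; rewrite ?gtrBl ?ltrDl.
pose S : set R := [set t | 0 <= t <= 1 /\ Q 0 t].
have S0 : S 0 by split; [rewrite lexx ler01|apply: Qrefl; rewrite lexx ler01].
have supS : has_sup S.
  by split; [exists 0|exists 1 => t [/andP[]]].
have c0 : 0 <= sup S by apply: ub_le_sup => //; case: supS.
have c1 : sup S <= 1 by apply: ge_sup; [exists 0|move=> t [/andP[]]].
have [|d d0 Qd] := Qloc (sup S); first by rewrite c0.
have [s Ss ds] := sup_adherent d0 supS.
have sc : s <= sup S by apply: ub_le_sup => //; case: supS.
case: Ss => /andP[s0 s1] Qs.
pose v := Num.min 1 (sup S + d / 2).
have cv : sup S <= v by rewrite /v le_min c1/=; lra.
have Qv : Q 0 v.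
  apply: (Qtrans _ s) => //; first exact: le_trans cv.
  apply: Qd => //; last by rewrite /v ge_min lexx.
  by apply: (@le_lt_trans _ _ (sup S + d / 2)); [rewrite /v ge_min lexx orbT|lra].
suff -> : 1 = v by [].
have Sv : S v.
  by split=> //; rewrite (le_trans c0 cv)/= /v ge_min lexx.
have : v <= sup S by apply: ub_le_sup => //; case: supS.
by rewrite {1}/v ge_min => /orP[H|]; [apply/le_anti; rewrite (le_trans H cv) /v ge_min lexx|lra].
Qed.

(** Segments are parametrized by real numbers while points have coordinates in
    K; every argument along a segment is carried out once for both fields through
    this embedding.  The last field expresses that nonnegative elements of K, which
    measure radii and errors, are real. *)
Record real_embedding (R : realType) (K : numFieldType) := RealEmbedding {
  emb :> {rmorphism R -> K};
  emb_le : {mono emb : x y / x <= y};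
  emb_onto : forall x : K, 0 <= x -> exists y, x = emb y
}.

Section Embedding.
Context {R : realType} {K : numFieldType} (iota : real_embedding R K).

Lemma emb_lt : {mono iota : x y / x < y}.
Proof. exact/leW_mono/emb_le. Qed.

Lemma emb_ge0 x : (0 <= iota x) = (0 <= x).
Proof. by rewrite -{1}(rmorph0 iota) emb_le. Qed.

Lemma emb_norm x : `|iota x| = iota `|x|.
Proof.
have [x0|x0] := leP 0 x; first by rewrite !ger0_norm ?emb_ge0.
rewrite !ltr0_norm ?rmorphN//.
by rewrite -(rmorph0 iota) emb_lt.
Qed.

Lemma emb_pos x : 0 < x -> exists2 y, 0 < y & x = iota y.
Proof.
move=> x0; have [y xy] := emb_onto iota (ltW x0); exists y => //.
by rewrite -emb_lt rmorph0 -xy.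
Qed.

Lemma emb_small (x : K) : 0 < x -> exists2 y, 0 < y & forall t, `|t| < y -> `|iota t| < x.
Proof.
move=> /emb_pos[y y0 ->]; exists y => // t ty.
by rewrite emb_norm emb_lt.
Qed.

End Embedding.

(** Replaces the minimum, as the order of K is only partial. *)
Lemma pos_lower_bound (K : numFieldType) (x y : K) : 0 < x -> 0 < y ->
  exists2 z, 0 < z & z <= x /\ z <= y.
Proof.
move=> x0 y0; have [xy|yx] := real_leP (gtr0_real x0) (gtr0_real y0).
  by exists x.
by exists y => //; split => //; apply: ltW.
Qed.

(** The form without quotient, with an error bound valid at h = 0 too, is the one
    that adds up along subdivisions. *)
Lemma is_deriveP (K : numFieldType) (V W : normedModType K) (f : V -> W) x v d :
  is_derive x v f d <->
  forall e : K, 0 < e -> exists2 r : K, 0 < r & forall h, `|h| < r ->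
    `|f (x + h *: v) - f x - h *: d| <= e * `|h|.
Proof.
split=> [[df dfE] e e0|fd].
  move: df; rewrite /derivable -/(derive f x v) => /cvg_ex[l fl].
  have dl : d = l by rewrite -dfE; apply: cvg_lim.
  move/cvgrPdist_le: fl => /(_ e e0).
  rewrite near_withinE => /nbhs_ballP[r /= r0 Hr]; exists r => // h hr.
  have [->|h0] := eqVneq h 0.
    by rewrite !scale0r addr0 subrr subr0 !normr0 mulr0.
  have := Hr h; rewrite -ball_normE/= sub0r normrN => /(_ hr h0).
  rewrite -dl => Hd.
  have -> : f (x + h *: v) - f x - h *: d
      = - (h *: (d - h^-1 *: (f (h *: v + x) - f x))).
    by rewrite (scalerBr h d) scalerA mulfV// scale1r opprB [x + _]addrC.
  by rewrite normrN normrZ mulrC ler_wpM2r.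
have lim_d : (fun h => h^-1 *: ((f \o shift x) (h *: v) - f x)) @ 0^' --> d.
  apply/cvgrPdist_le => e e0; have [r r0 Hr] := fd e e0.
  rewrite near_withinE; apply/nbhs_ballP; exists r => // h.
  rewrite -ball_normE/= sub0r normrN => hr h0; have := Hr h hr.
  have -> : d - h^-1 *: (f (h *: v + x) - f x)
      = - (h^-1 *: (f (x + h *: v) - f x - h *: d)).
    by rewrite (scalerBr h^-1 (_ - _) (_ *: _)) scalerA mulVf// scale1r opprB [x + _]addrC.
  rewrite normrN normrZ normfV ler_pdivrMl ?normr_gt0//.
  by rewrite mulrC.
by split; [apply/cvg_ex; exists d|exact/cvg_lim].
Qed.

Lemma is_derive_quadratic (K : numFieldType) (V W : normedModType K) (f : V -> W)
    x v d (r C : K) : 0 < r -> 0 <= C ->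
    (forall h, `|h| < r -> `|f (x + h *: v) - f x - h *: d| <= C * `|h| ^+ 2) ->
  is_derive x v f d.
Proof.
move=> r0 C0 fd; apply/is_deriveP => e e0.
have [s s0 [sr sC]] := pos_lower_bound r0 (divr_gt0 e0 (ltr_wpDl C0 ltr01)).
exists s => // h hs; apply: le_trans (fd h (lt_le_trans hs sr)) _.
rewrite expr2 mulrA ler_wpM2r//.
have C1 : 0 < C + 1 by rewrite ltr_wpDl.
apply: (@le_trans _ _ ((C + 1) * `|h|)).
  by rewrite ler_wpM2r// lerDl.
by rewrite mulrC -ler_pdivlMr// (le_trans (ltW hs)).
Qed.

(** There is no intermediate point when f has complex values, but the increments
    over short intervals around each t are at most M + e times their length, and
    such bounds add up. *)
Lemma mean_value_ineq (R : realType) (K : numFieldType)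
    (iota : real_embedding R K) (V W : normedModType K)
    (f : V -> W) (df : V -> W) (x v : V) (M : K) :
    (forall t : R, 0 <= t <= 1 ->
       is_derive (x + iota t *: v) v f (df (x + iota t *: v)) /\
       `|df (x + iota t *: v)| <= M) ->
  `|f (x + v) - f x| <= M.
Proof.
move=> Hf; apply/ler_addgt0Pr => e e0.
pose p t := x + iota t *: v.
suff : `|f (p 1) - f (p 0)| <= (M + e) * iota (1 - 0).
  by rewrite /p rmorph1 rmorph0 scale1r scale0r addr0 subr0 rmorph1 mulr1.
apply: (@cousin_01 R (fun u w => `|f (p w) - f (p u)| <= (M + e) * iota (w - u))).
  move=> u t w _ _ Hut Htw.
  have -> : f (p w) - f (p u) = (f (p w) - f (p t)) + (f (p t) - f (p u)).
    by rewrite subrKA.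
  apply: le_trans (ler_normD _ _) _; rewrite addrC.
  apply: le_trans (lerD Hut Htw) _.
  by rewrite -mulrDr -rmorphD/= [t - u + _]addrC subrKA.
move=> t /Hf[/is_deriveP/(_ e e0)[r r0 Hr] dM].
have [d d0 Hd] := emb_small iota r0; exists d => // u w u0 ut1 ut tw wt1 w1.
have bnd s : `|s - t| < d -> `|f (p s) - f (p t)| <= (M + e) * iota `|s - t|.
  move=> st; have := Hr (iota (s - t)) (Hd _ st).
  have -> : x + iota t *: v + iota (s - t) *: v = p s.
    by rewrite /p -addrA -scalerDl -rmorphD/= subrKC.
  move=> H.
  rewrite -(subrK (iota (s - t) *: df (p t)) (f (p s) - f (p t))).
  apply: le_trans (ler_normD _ _) _; rewrite addrC mulrDl lerD//.
    by rewrite normrZ emb_norm mulrC ler_wpM2r// emb_ge0.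
  by rewrite -emb_norm.
have -> : f (p w) - f (p u) = (f (p w) - f (p t)) - (f (p u) - f (p t)).
  by rewrite opprB subrKA.
apply: le_trans (ler_normB _ _) _.
have := lerD (bnd w _) (bnd u _).
rewrite -mulrDr -rmorphD/= ger0_norm ?subr_ge0// ler0_norm ?subr_le0//.
have -> : w - t + - (u - t) = w - u by ring.
by apply; lra.
Qed.

(** * Primitives on open convex sets *)

Section Columns.
Context {K : numFieldType} {n : nat}.
Implicit Types (x y z v : 'cV[K]_n) (e : K).

Definition unit_vec (i : 'I_n) : 'cV[K]_n := delta_mx i 0.

Lemma coord_le_norm x i : `|x i 0| <= `|x|.
Proof.
apply/ler_addgt0Pr => e e0.
have : ball_ (fun x => `| x |) x (`|x| + e) 0 by rewrite /= subr0 ltrDl.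
rewrite -mx_norm_ball => -[_ /(_ i 0)].
by rewrite -ball_normE/= mxE subr0 => /ltW.
Qed.

Lemma norm_ltP x e : 0 < e -> (forall i, `|x i 0| < e) -> `|x| < e.
Proof.
move=> e0 H; suff : ball_ (fun x => `| x |) x e 0 by rewrite /= subr0.
rewrite -mx_norm_ball; split=> // i j; rewrite ord1 mxE.
by rewrite -ball_normE/= subr0.
Qed.

Lemma norm_unit_vec_le i : `|unit_vec i| <= 1.
Proof.
apply/ler_addgt0Pr => e e0; apply/ltW/norm_ltP => [|j].
  by rewrite addr_gt0.
by rewrite mxE andbT; case: eqP => _; rewrite ?normr1 ?normr0 ?ltrDl ?addr_gt0.
Qed.

Lemma norm_scale_unit_vec_le i h : `|h *: unit_vec i| <= `|h|.
Proof. by rewrite normrZ ler_piMr// norm_unit_vec_le. Qed.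

End Columns.

Lemma is_derive_scale_dir (K : numFieldType) (V : normedModType K) (f : V -> K)
  x v d (s : K) : is_derive x v f d -> is_derive x (s *: v) f (s * d).
Proof.
move=> /is_deriveP Hf; apply/is_deriveP => e e0.
have s1 : 0 < `|s| + 1 by rewrite ltr_wpDl.
have [r r0 Hr] := Hf (e / (`|s| + 1)) (divr_gt0 e0 s1).
exists (r / (`|s| + 1)); first by rewrite divr_gt0.
move=> h; rewrite ltr_pdivlMr// => hr.
have hs : `|h * s| <= `|h| * (`|s| + 1) by rewrite normrM ler_wpM2l// lerDl.
have := Hr (h * s) (le_lt_trans hs hr).
rewrite -scalerA -[(h * s) *: d]/(h * s * d) -mulrA => /le_trans; apply.
rewrite mulrAC ler_pdivrMr// -mulrA ler_wpM2l// ltW//.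
Qed.

Section Gradients.
Context {K : numFieldType} {n : nat}.
Implicit Types (x y : 'cV[K]_n) (P Q : 'cV[K]_n -> K)
  (F : 'cV[K]_n -> 'cV[K]_n) (U : set 'cV[K]_n).

(** Carries the existence of the partial derivatives, which an equation between
    values of [grad] does not. *)
Definition gradient_on U P F := forall x, U x -> forall i,
  is_derive x (unit_vec i) P (F x i 0).

Lemma gradient_onS U V P F : V `<=` U -> gradient_on U P F -> gradient_on V P F.
Proof. by move=> VU HP x /VU; apply: HP. Qed.

Lemma gradient_on_eq U P Q F : open U -> (forall x, U x -> P x = Q x) ->
  gradient_on U P F -> gradient_on U Q F.
Proof.
move=> oU PQ HP x Ux i; apply: (near_eq_is_derive (f := P)) (HP x Ux i).
by apply: filterS (open_nbhs_nbhs (conj oU Ux)) => y /PQ.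
Qed.

Lemma gradient_onB U P Q F G : gradient_on U P F -> gradient_on U Q G ->
  gradient_on U (fun x => P x - Q x) (fun x => F x - G x).
Proof.
move=> HP HQ x Ux i; rewrite !mxE.
exact: (is_deriveB (HP x Ux i) (HQ x Ux i)).
Qed.

Lemma gradient_onDc U P F c : gradient_on U P F ->
  gradient_on U (fun x => P x + c) F.
Proof.
move=> HP x Ux i; rewrite -[F x i 0]addr0.
exact: (is_deriveD (HP x Ux i) (is_derive_cst _ _ _)).
Qed.

Lemma is_derive_coord x v (j : 'I_n) :
  is_derive x v (fun y : 'cV[K]_n => y j 0) (v j 0).
Proof.
apply/is_deriveP => e e0; exists 1 => // h _.
rewrite !mxE [x j 0 + _]addrC addrK -[h *: _]/(h * _) subrr normr0.
by rewrite mulr_ge0// ltW.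
Qed.

End Gradients.

Section MeanValue.
Context {R : realType} {K : numFieldType} (iota : real_embedding R K) {n : nat}.
Implicit Types (x y z v : 'cV[K]_n) (P Q : 'cV[K]_n -> K)
  (F : 'cV[K]_n -> 'cV[K]_n) (U : set 'cV[K]_n).

(** The points visited when z is moved to z + v one coordinate at a time all lie
    in this box, which is inside every sup-norm ball containing z and z + v. *)
Definition box z v : set 'cV[K]_n := [set y | forall i, exists2 t : R,
  0 <= t <= 1 & y i 0 = z i 0 + iota t * v i 0].

Lemma emb_itv01 t : 0 <= t <= 1 -> 0 <= iota t /\ iota t <= 1.
Proof.
by move=> /andP[t0 t1]; rewrite emb_ge0 -(rmorph1 iota) emb_le.
Qed.

Lemma lt_convex_comb (t : R) (p q e : K) : 0 <= t <= 1 -> `|p| < e -> `|q| < e ->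
  `|(1 - iota t) * p + iota t * q| < e.
Proof.
move=> t01 pe qe; have [t0 t1] := emb_itv01 t01.
have [r r0 [rp rq]] : exists2 r : K, 0 < r & r <= e - `|p| /\ r <= e - `|q|.
  by apply: pos_lower_bound; rewrite subr_gt0.
apply: (@le_lt_trans _ _ (e - r)); last by rewrite gtrBl.
rewrite (le_trans (ler_normD _ _))// !normrM (ger0_norm t0) ger0_norm ?subr_ge0//.
have -> : e - r = (1 - iota t) * (e - r) + iota t * (e - r) by ring.
by rewrite lerD// ler_wpM2l ?subr_ge0// lerBrDr addrC -lerBrDr.
Qed.

Lemma box_in_ball a z v r y : ball a r z -> ball a r (z + v) -> box z v y ->
  ball a r y.
Proof.
rewrite -ball_normE/= => az azv yb.
have r0 : 0 < r by apply: le_lt_trans az.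
apply: norm_ltP => // i; have [t t01 yE] := yb i; rewrite !mxE yE.
have -> : a i 0 - (z i 0 + iota t * v i 0) =
    (1 - iota t) * (a i 0 - z i 0) + iota t * (a i 0 - (z i 0 + v i 0)) by ring.
apply: lt_convex_comb => //.
  by apply: le_lt_trans az; rewrite (le_trans _ (coord_le_norm _ i))// !mxE.
by apply: le_lt_trans azv; rewrite (le_trans _ (coord_le_norm _ i))// !mxE.
Qed.

Lemma box_norm z v y : box z v y -> `|y - z| <= `|v|.
Proof.
move=> yb; apply/ler_addgt0Pr => e e0; apply/ltW/norm_ltP => [|i].
  by rewrite ltr_wpDl.
have [t t01 yE] := yb i; have [t0 t1] := emb_itv01 t01.
rewrite !mxE yE [z i 0 + _]addrC addrK normrM (ger0_norm t0).
apply: (@le_lt_trans _ _ (1 * `|v|)); last by rewrite mul1r ltrDl.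
by rewrite ler_pM// coord_le_norm.
Qed.

(** Moving one coordinate at a time needs partial derivatives only, whereas a
    direct path would need differentiability. *)
Lemma mean_value_box P F z v (M : K) : 0 <= M ->
    gradient_on (box z v) P F ->
    (forall y, box z v y -> forall i, `|F y i 0| <= M) ->
  `|P (z + v) - P z| <= n%:R * (M * `|v|).
Proof.
move=> M0 HP HM.
pose w k := \col_i (if (i < k)%N then v i 0 else 0) : 'cV[K]_n.
suff H k : (k <= n)%N -> `|P (z + w k) - P z| <= k%:R * (M * `|v|).
  have <- : w n = v by apply/colP => i; rewrite mxE ltn_ord.
  apply: le_trans (H n (leqnn _)) _; rewrite (_ : w n = v)//.
  by apply/colP => i; rewrite mxE ltn_ord.
elim: k => [_|k IHk kn].
  have -> : w 0%N = 0 by apply/colP => i; rewrite !mxE.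
  by rewrite addr0 subrr normr0 mul0r.
pose i := Ordinal kn.
have wS : z + w k.+1 = z + w k + v i 0 *: unit_vec i.
  rewrite -addrA; congr (_ + _); apply/colP => j; rewrite !mxE/=.
  rewrite andbT ltnS leq_eqVlt -(inj_eq val_inj)/=.
  case: (eqVneq (j : nat) k) => [jk|_].
    by rewrite jk ltnn add0r mulr1; congr (v _ 0); apply: val_inj.
  by rewrite mulr0 addr0.
rewrite -(subrKA (P (z + w k))).
apply: le_trans (ler_normD _ _) _.
rewrite -natr1 mulrDl addrC lerD ?IHk 1?ltnW// mul1r wS.
apply: (mean_value_ineq (iota := iota) (df := fun y => v i 0 * F y i 0)) => t t01.
have by_ : box z v (z + w k + iota t *: (v i 0 *: unit_vec i)).
  move=> j; rewrite !mxE/= andbT -(inj_eq val_inj)/=.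
  case: (ltngtP j k) => jk.
  - exists 1; first by rewrite ler01 lexx.
    by rewrite !mulr0 addr0 rmorph1 mul1r.
  - exists 0; first by rewrite ler01 lexx.
    by rewrite !mulr0 !addr0 rmorph0 mul0r addr0.
  - exists t => //; rewrite addr0 mulr1; congr (_ + _ * v _ 0); exact: val_inj.
split; first by apply/is_derive_scale_dir/HP.
by rewrite normrM mulrC ler_pM// ?HM// coord_le_norm.
Qed.

Definition segment_convex U := forall x y (t : R), U x -> U y -> 0 <= t <= 1 ->
  U (x + iota t *: (y - x)).

Lemma segment_convexI U V : segment_convex U -> segment_convex V ->
  segment_convex (U `&` V).
Proof. by move=> cU cV x y t [Ux Vx] [Uy Vy] t01; split; [exact: cU|exact: cV]. Qed.

Lemma segment_convex_ball a r : segment_convex (ball a r).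
Proof.
move=> x y t ax ay t01; apply: (@box_in_ball a x (y - x)) => //.
  by rewrite subrKC.
by move=> i; exists t => //; rewrite !mxE.
Qed.

(** P is constant on small balls by [mean_value_box]; equality of the values at
    the ends of an interval is additive, so Cousin's lemma applies. *)
Lemma zero_gradient_cst U P : open U -> segment_convex U ->
  gradient_on U P (fun=> 0) -> forall x y, U x -> U y -> P y = P x.
Proof.
move=> oU cU HP x y Ux Uy.
pose p t := x + iota t *: (y - x).
suff : P (p 1) = P (p 0).
  by rewrite /p rmorph1 rmorph0 scale0r scale1r addr0 subrKC.
apply: (@cousin_01 R (fun u w => P (p w) = P (p u))).
  by move=> u v w _ _ -> ->.
move=> t t01; have Upt : U (p t) by apply: cU.
have /nbhs_ballP[r /= r0 rU] := open_nbhs_nbhs (conj oU Upt).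
have N0 : 0 < `|y - x| + 1 by rewrite ltr_wpDl.
have [d d0 Hd] := emb_small iota (divr_gt0 r0 N0).
have pr s : `|s - t| < d -> ball (p t) r (p s).
  move=> /Hd; rewrite ltr_pdivlMr// => H.
  rewrite -ball_normE/= /p opprD addrACA subrr add0r -scalerBl -rmorphB.
  rewrite normrZ /= rmorphB/= distrC -rmorphB; apply: le_lt_trans H.
  by rewrite ler_wpM2l// lerDl.
have cstb q : ball (p t) r q -> P q = P (p t).
  move=> pq; apply/eqP; rewrite -subr_eq0 -normr_le0.
  have := @mean_value_box P (fun=> 0) (p t) (q - p t) 0 (lexx _).
  rewrite subrKC mul0r mulr0; apply; last first.
    by move=> ? _ i; rewrite mxE normr0.
  apply: gradient_onS HP; apply: subset_trans rU => z.
  by apply: box_in_ball; [exact: ballxx|rewrite subrKC].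
exists d => // u w u0 ut1 ut tw wt1 w1.
by rewrite !cstb//; apply: pr; rewrite ltr_norml; lra.
Qed.

Lemma same_gradient U P Q F : open U -> segment_convex U ->
    gradient_on U P F -> gradient_on U Q F ->
  forall x y, U x -> U y -> Q y - P y = Q x - P x.
Proof.
move=> oU cU HP HQ; apply: zero_gradient_cst => //.
by move=> x Ux i; have := gradient_onB HQ HP Ux i; rewrite subrr.
Qed.

(** The e-neighbourhood of a piece of the segment from a in direction d.  Tubes
    are open and convex, and consecutive tubes of equal radius cover the tube of
    the whole piece. *)
Definition tube a d (u w : R) (e : K) : set 'cV[K]_n :=
  [set y | exists2 t, u <= t <= w & `|y - (a + iota t *: d)| < e].

Lemma open_tube a d u w e : open (tube a d u w e).
Proof.
rewrite openE => y [t tuw ye]; apply/nbhs_ballP.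
exists (e - `|y - (a + iota t *: d)|); rewrite /= ?subr_gt0// => z.
rewrite -ball_normE/= ltrBrDr => yz; exists t => //; apply: le_lt_trans yz.
by rewrite -(subrKA y) distrC [X in _ <= X]addrC addrC (le_trans (ler_normD _ _))// addrC distrC.
Qed.

Lemma segment_convex_tube a d u w e : segment_convex (tube a d u w e).
Proof.
move=> x y s [t1 /andP[ut1 t1w] xe] [t2 /andP[ut2 t2w] ye] s01.
exists (t1 + s * (t2 - t1)).
  by move: s01 => /andP[s0 s1]; apply/andP; split; nra.
have e0 : 0 < e by apply: le_lt_trans xe.
apply: norm_ltP => // i.
rewrite !mxE rmorphD rmorphM rmorphB.
have -> : x i 0 + iota s * (y i 0 - x i 0)
    - (a i 0 + (iota t1 + iota s * (iota t2 - iota t1)) * d i 0)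
  = (1 - iota s) * (x i 0 - (a i 0 + iota t1 * d i 0))
    + iota s * (y i 0 - (a i 0 + iota t2 * d i 0)) by ring.
apply: lt_convex_comb => //.
  by apply: le_lt_trans xe; rewrite (le_trans _ (coord_le_norm _ i))// !mxE.
by apply: le_lt_trans ye; rewrite (le_trans _ (coord_le_norm _ i))// !mxE.
Qed.

(** On the convex intersection the two primitives differ by a constant, fixed by
    their values at z. *)
Lemma glue_gradient_pair U V P Q F z : open U -> open V ->
    segment_convex U -> segment_convex V -> U z -> V z ->
    gradient_on U P F -> gradient_on V Q F ->
  exists S, gradient_on (U `|` V) S F.
Proof.
move=> oU oV cU cV Uz Vz HP HQ.
have oUV : open (U `&` V) by apply: openI.
have PQ x : U x -> V x -> Q x - P x = Q z - P z.
  move=> Ux Vx; apply: (same_gradient oUV (segment_convexI cU cV) (F := F)) => //.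
    by apply: gradient_onS HP; apply: subIsetl.
  by apply: gradient_onS HQ; apply: subIsetr.
pose S x := if x \in U then P x else Q x - (Q z - P z).
have SU : gradient_on U S F.
  by apply: gradient_on_eq HP => // x Ux; rewrite /S mem_set.
have SV : gradient_on V S F.
  apply: gradient_on_eq (gradient_onDc (- (Q z - P z)) HQ) => // x Vx; rewrite /S.
  by case: ifP => // /set_mem Ux; rewrite -(PQ x)// opprB addrC subrK.
by exists S => x [Ux|Vx]; [exact: SU|exact: SV].
Qed.

(** Cousin's lemma continues a primitive along the segment from a to x, giving one
    on a tube around it.  The value at x, normalized to vanish at a, is the same
    for every tube containing the segment because two tubes meet in a convex open
    set; so near x the values come from a single primitive. *)
Lemma glue_gradient U F : open U -> segment_convex U ->
    (forall x, U x -> exists2 r : K, 0 < r & exists P, gradient_on (ball x r) P F) ->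
  exists P, gradient_on U P F.
Proof.
move=> oU cU loc.
have [[a Ua]|noU] := pselect (exists a, U a); last first.
  by exists (fun=> 0) => x Ux; case: noU; exists x.
have tubeP x : U x -> exists2 e : K, 0 < e &
    exists P, gradient_on (tube a (x - a) 0 1 e) P F.
  move=> Ux; pose p t := a + iota t *: (x - a).
  apply: (@cousin_01 R (fun u w => exists2 e : K, 0 < e &
    exists P, gradient_on (tube a (x - a) u w e) P F)).
    move=> u v w uv vw [e1 e10 [P1 H1]] [e2 e20 [P2 H2]].
    have [e e0 [ee1 ee2]] := pos_lower_bound e10 e20; exists e => //.
    have H1' : gradient_on (tube a (x - a) u v e) P1 F.
      apply: gradient_onS H1 => y [t tuv yt]; exists t => //.
      exact: lt_le_trans ee1.
    have H2' : gradient_on (tube a (x - a) v w e) P2 F.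
      apply: gradient_onS H2 => y [t tuv yt]; exists t => //.
      exact: lt_le_trans ee2.
    have [|||||| S HS] := @glue_gradient_pair _ _ P1 P2 F (p v) _ _ _ _ _ _ H1' H2'.
    - exact: open_tube.
    - exact: open_tube.
    - exact: segment_convex_tube.
    - exact: segment_convex_tube.
    - by exists v; rewrite ?uv ?lexx// /p subrr normr0.
    - by exists v; rewrite ?vw ?lexx// /p subrr normr0.
    exists S; apply: gradient_onS HS => y [t /andP[ut tw] yt].
    have [tv|/ltW vt] := leP t v; [left|right]; exists t => //; apply/andP; split => //.
  move=> t t01; have Upt : U (p t) by apply: cU.
  have [r r0 [P HP]] := loc _ Upt.
  have r20 : 0 < r / 2 by rewrite divr_gt0.
  have N0 : 0 < `|x - a| + 1 by rewrite ltr_wpDl.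
  have [d d0 Hd] := emb_small iota (divr_gt0 r20 N0).
  exists d => // u w u0 ut1 ut tw wt1 w1.
  exists (r / 2) => //; exists P.
  apply: gradient_onS HP => y [s /andP[us sw] ys].
  have /Hd : `|t - s| < d by rewrite ltr_norml; lra.
  rewrite ltr_pdivlMr// => H.
  rewrite -ball_normE/= -(subrKA (p s)).
  apply: le_lt_trans (ler_normD _ _) _; rewrite [r]splitr ltrD//; last by rewrite distrC.
  rewrite /p opprD addrACA subrr add0r -scalerBl -rmorphB normrZ.
  by apply: le_lt_trans H; rewrite ler_wpM2l// lerDl.
pose T x e := tube a (x - a) 0 1 e.
have /choice[eP HeP] : forall x, exists eP : K * ('cV[K]_n -> K),
    U x -> 0 < eP.1 /\ gradient_on (T x eP.1) eP.2 F.
  move=> x; have [Ux|nUx] := pselect (U x); last by exists (0, fun=> 0).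
  by have [e e0 [P HP]] := tubeP x Ux; exists (e, P).
pose T' x := T x (eP x).1.
have Ta x : U x -> T' x a.
  move=> /HeP[e0 _]; exists 0; rewrite ?lexx ?ler01//.
  by rewrite rmorph0 scale0r addr0 subrr normr0.
have Tx x : U x -> T' x x.
  move=> /HeP[e0 _]; exists 1; rewrite ?lexx ?ler01//.
  by rewrite rmorph1 scale1r subrKC subrr normr0.
have oT x : open (T' x) by apply: open_tube.
have cT x : segment_convex (T' x) by apply: segment_convex_tube.
(* The tube of x contains a and all points near x, so it computes h there. *)
pose h x := (eP x).2 x - (eP x).2 a.
exists h => x Ux.
have gx := (HeP x Ux).2.
suff : gradient_on (U `&` T' x) h F by apply; split=> //; apply: Tx.
apply: (gradient_on_eq (P := fun y => (eP x).2 y - (eP x).2 a)).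
- exact: openI.
- move=> y [Uy Txy]; rewrite /h.
  have gy := (HeP y Uy).2.
  have := same_gradient (openI (oT x) (oT y)) (segment_convexI (cT x) (cT y))
    (gradient_onS (@subIsetl _ _ _) gx) (gradient_onS (@subIsetr _ _ _) gy)
    (conj (Ta _ Ux) (Ta _ Uy)) (conj Txy (Tx _ Uy)).
  move=> E; apply/eqP; rewrite -subr_eq0; apply/eqP.
  move/eqP: E; rewrite -subr_eq0 => /eqP E; rewrite -oppr0 -E; ring.
- by apply: gradient_onDc; apply: gradient_onS gx; apply: subIsetr.
Qed.

End MeanValue.

(** * Mixed partial derivatives and Taylor bounds *)

Lemma is_derive_comp_shift (K : numFieldType) (V : normedModType K) (f : V -> K)
  x v w d : is_derive (x + w) v f d -> is_derive x v (fun y => f (y + w)) d.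
Proof.
move=> /is_deriveP Hf; apply/is_deriveP => e /Hf[r r0 Hr]; exists r => // h /Hr.
by rewrite (addrAC x w).
Qed.

Lemma mean_value_scaled (R : realType) (K : numFieldType)
    (iota : real_embedding R K) (V : normedModType K)
    (f : V -> K) (df : V -> K) (x v : V) (s M : K) :
    (forall t : R, 0 <= t <= 1 ->
       is_derive (x + iota t *: (s *: v)) v f (df (x + iota t *: (s *: v))) /\
       `|df (x + iota t *: (s *: v))| <= M) ->
  `|f (x + s *: v) - f x| <= `|s| * M.
Proof.
move=> Hf.
apply: (mean_value_ineq (iota := iota) (df := fun y => s * df y)) => t /Hf[H1 H2].
by split; [exact: is_derive_scale_dir|rewrite normrM ler_wpM2l].
Qed.

Section Schwarz.
Context {R : realType} {K : numFieldType} (iota : real_embedding R K) {n : nat}.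
Implicit Types (x y z v : 'cV[K]_n) (P : 'cV[K]_n -> K).

Lemma emb_scale_small (t : R) (s q : K) (i : 'I_n) : 0 <= t <= 1 -> `|s| < q ->
  `|iota t *: (s *: unit_vec i : 'cV[K]_n)| < q.
Proof.
move=> t01 sq; have [t0 t1] := emb_itv01 iota t01.
rewrite normrZ (ger0_norm t0); apply: le_lt_trans sq.
by rewrite (le_trans _ (norm_scale_unit_vec_le i s))// ler_piMl.
Qed.

(** The second difference is symmetric in the two directions, but this bound
    compares it with s t c where c is close to one of the two mixed derivatives
    only: exchanging the roles gives Schwarz's theorem. *)
Lemma second_difference_bound P (Pi Pij : 'cV[K]_n -> K) i j x (r e c s t : K) :
    (forall y, `|y - x| < r -> is_derive y (unit_vec i) P (Pi y)) ->
    (forall y, `|y - x| < r -> is_derive y (unit_vec j) Pi (Pij y)) ->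
    (forall y, `|y - x| < r -> `|Pij y - c| <= e) ->
    `|s| < r / 2 -> `|t| < r / 2 ->
  `|P (x + s *: unit_vec i + t *: unit_vec j) - P (x + s *: unit_vec i)
    - (P (x + t *: unit_vec j) - P x) - s * (t * c)| <= `|s| * (`|t| * e).
Proof.
move=> dP dPi Pijc sr tr.
(* The expression is the increment of W in direction i; its derivative is in
   turn an increment of Pi - c y_j in direction j. *)
pose W y := P (y + t *: unit_vec j) - P y - t * c * y i 0.
have WE : P (x + s *: unit_vec i + t *: unit_vec j) - P (x + s *: unit_vec i)
    - (P (x + t *: unit_vec j) - P x) - s * (t * c) = W (x + s *: unit_vec i) - W x.
  by rewrite /W !mxE !eqxx mulr1; ring.
rewrite WE.
pose dW y := Pi (y + t *: unit_vec j) - Pi y - t * c * 1.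
apply: (mean_value_scaled (iota := iota) (df := dW)) => u u01.
set y := x + _.
have yx : `|y - x| < r / 2 by rewrite /y addrC addKr emb_scale_small.
clearbody y.
have r2 : r / 2 < r.
  rewrite ltr_pdivrMr// mulr_natr mulr2n ltrDl -(pmulr_lgt0 _ (_ : 0 < 2^-1)) ?invr_gt0//.
  exact: le_lt_trans tr.
split.
  apply: is_deriveB.
    apply: is_deriveB; last by apply: dP; apply: lt_trans r2.
    apply: is_derive_comp_shift; apply: dP.
    rewrite addrAC [r]splitr (le_lt_trans (ler_normD _ _))// ltrD//.
    by apply: le_lt_trans tr; apply: norm_scale_unit_vec_le.
  have -> : (fun z : 'cV[K]_n => t * c * z i 0) = (t * c) *: (fun z : 'cV[K]_n => z i 0).
    by [].
  apply: is_deriveZ; have := is_derive_coord y (unit_vec i) i.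
  by rewrite mxE !eqxx.
rewrite /dW mulr1.
have -> : Pi (y + t *: unit_vec j) - Pi y - t * c =
   (Pi (y + t *: unit_vec j) - c * (y + t *: unit_vec j) j 0) - (Pi y - c * y j 0).
  by rewrite !mxE !eqxx mulr1; ring.
apply: (mean_value_scaled (iota := iota) (f := fun z => Pi z - c * z j 0)
  (df := fun z => Pij z - c * 1)) => q q01.
have zx : `|y + iota q *: (t *: unit_vec j) - x| < r.
  rewrite addrAC [r]splitr (le_lt_trans (ler_normD _ _))// ltrD//.
  exact: emb_scale_small.
split; last by rewrite mulr1; apply: Pijc.
apply: is_deriveB; first exact: dPi.
have -> : (fun z : 'cV[K]_n => c * z j 0) = c *: (fun z : 'cV[K]_n => z j 0).
  by [].
apply: is_deriveZ.
have := is_derive_coord (y + iota q *: (t *: unit_vec j)) (unit_vec j) j.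
by rewrite [in X in is_derive _ _ _ X]mxE !eqxx.
Qed.

Lemma continuous_at_norm (f : 'cV[K]_n -> K) x : {for x, continuous f} ->
  forall e : K, 0 < e -> exists2 r : K, 0 < r & forall y, `|y - x| < r -> `|f y - f x| <= e.
Proof.
move=> /cvgrPdist_le Hf e /Hf /nbhs_ballP[r /= r0 Hr]; exists r => // y yx.
by rewrite distrC; apply: Hr; rewrite -ball_normE/= distrC.
Qed.

Lemma schwarz P (Pi Pj Pij Pji : 'cV[K]_n -> K) i j x (r : K) : 0 < r ->
    (forall y, `|y - x| < r -> is_derive y (unit_vec i) P (Pi y)) ->
    (forall y, `|y - x| < r -> is_derive y (unit_vec j) P (Pj y)) ->
    (forall y, `|y - x| < r -> is_derive y (unit_vec j) Pi (Pij y)) ->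
    (forall y, `|y - x| < r -> is_derive y (unit_vec i) Pj (Pji y)) ->
    {for x, continuous Pij} -> {for x, continuous Pji} ->
  Pij x = Pji x.
Proof.
move=> r0 dPi dPj dPij dPji cij cji.
apply/eqP; rewrite -subr_eq0 -normr_le0; apply/ler_addgt0Pr => e e0.
have e20 : 0 < e / 2 by rewrite divr_gt0.
have [r1 r10 H1] := continuous_at_norm cij e20.
have [r2 r20 H2] := continuous_at_norm cji e20.
have [r3 r30 [r31 r32]] := pos_lower_bound r10 r20.
have [q q0 [qr qr3]] := pos_lower_bound r0 r30.
pose s := q / 4.
have s0 : 0 < s by rewrite divr_gt0.
have sq : `|s| < q / 2.
  rewrite gtr0_norm// /s ltr_pM2l// ltf_pV2 ?posrE//.
  by rewrite ltr_nat.
clearbody s.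
have A := @second_difference_bound P Pi Pij i j x q (e / 2) (Pij x) s s.
have B := @second_difference_bound P Pj Pji j i x q (e / 2) (Pji x) s s.
have {}A := A (fun y h => dPi y (lt_le_trans h qr)) (fun y h => dPij y (lt_le_trans h qr))
  (fun y h => H1 y (lt_le_trans h (le_trans qr3 r31))) sq sq.
have {}B := B (fun y h => dPj y (lt_le_trans h qr)) (fun y h => dPji y (lt_le_trans h qr))
  (fun y h => H2 y (lt_le_trans h (le_trans qr3 r32))) sq sq.
have := lerD B A; rewrite [X in P X - P _ - _ - _](addrAC x).
rewrite add0r -mulrDr -mulrDr -splitr.
move=> AB; have {AB} := le_trans (ler_normB _ _) AB.
set X := (X in `|X|); have -> : X = s * (s * (Pij x - Pji x)) by rewrite /X; ring.
by rewrite !normrM (gtr0_norm s0) !ler_pM2l.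
Qed.

Lemma locally_bounded (I : finType) (phi : I -> 'cV[K]_n -> K) a :
    (forall i, {for a, continuous (phi i)}) ->
  exists2 r : K, 0 < r & exists2 M : K, 0 <= M &
    forall y, `|y - a| < r -> forall i, `|phi i y| <= M.
Proof.
move=> cphi.
have : \forall y \near a, forall i, `|phi i y - phi i a| <= 1.
  apply: (@filter_forall _ I (fun i => [set y | `|phi i y - phi i a| <= 1]) (nbhs a)) => i.
  have /cvgrPdist_le/(_ 1 ltr01) := cphi i.
  by apply: filterS => y /=; rewrite distrC.
move=> /nbhs_ballP[r /= r0 Hr]; exists r => //.
exists (\sum_i (`|phi i a| + 1)); first by apply: sumr_ge0 => i _; rewrite addr_ge0.
move=> y yr i; rewrite (bigD1 i)//= ler_wpDr//.
  by apply: sumr_ge0 => k _; rewrite addr_ge0.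
rewrite -[phi i y](subrK (phi i a)) (le_trans (ler_normD _ _))// addrC lerD//.
by apply: Hr; rewrite -ball_normE/= distrC.
Qed.

(** P minus the linear function with gradient F z has the gradient F y - F z,
    which is small by a first use of the mean value inequality. *)
Lemma taylor_bound P F (G : 'I_n -> 'cV[K]_n -> 'cV[K]_n) a (r M : K) z v : 0 <= M ->
    gradient_on (ball a r) P F ->
    (forall i, gradient_on (ball a r) (fun x => F x i 0) (G i)) ->
    (forall y, ball a r y -> forall i j, `|G i y j 0| <= M) ->
    ball a r z -> ball a r (z + v) ->
  `|P (z + v) - P z - \sum_i v i 0 * F z i 0| <= n%:R * (n%:R * M * `|v|) * `|v|.
Proof.
move=> M0 dP dF GM az azv.
have boxb y : box iota z v y -> ball a r y by apply: box_in_ball.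
pose L y : K := \sum_i F z i 0 * y i 0.
have -> : P (z + v) - P z - \sum_i v i 0 * F z i 0 = (P (z + v) - L (z + v)) - (P z - L z).
  have -> : L (z + v) = L z + \sum_i v i 0 * F z i 0.
    by rewrite /L -big_split; apply: eq_bigr => i _; rewrite mxE mulrDr [v i 0 * _]mulrC.
  by ring.
rewrite -[X in _ <= X]mulrA; apply: 
  (@mean_value_box _ _ iota _ (fun y => P y - L y) (fun y => F y - F z)).
- by rewrite !mulr_ge0.
- apply: gradient_onB; first exact: gradient_onS dP.
  move=> y _ i.
  have -> : L = \sum_k (fun y : 'cV[K]_n => F z k 0 * y k 0).
    by apply/funext => w; rewrite /L fct_sumE.
  have -> : F z i 0 = \sum_k (F z k 0 *: (unit_vec i : 'cV[K]_n) k 0).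
    rewrite (bigD1 i)//= mxE !eqxx big1 ?addr0; first by rewrite [_ *: _]mulr1.
    by move=> k ki; rewrite mxE (negPf ki) scaler0.
  apply: is_derive_sum => k.
  apply: is_deriveZ; exact: is_derive_coord.
move=> y yb i; rewrite !mxE.
have := @mean_value_box _ _ iota _ (fun x => F x i 0) (G i) z (y - z) M M0.
rewrite subrKC => H; apply: le_trans (H _ _) _.
- apply: gradient_onS (dF i) => w; apply: box_in_ball => //.
  by rewrite subrKC; apply: boxb.
- move=> w wb k; apply: GM; move: wb; apply: box_in_ball => //.
  by rewrite subrKC; apply: boxb.
by rewrite -[X in _ <= X]mulrA ler_wpM2l// ler_wpM2l// (box_norm yb).
Qed.

End Schwarz.

(** * Smooth functions *)

Section Smooth.
Context {K : numFieldType} {n : nat}.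
Implicit Types (f g h : 'cV[K]_n -> K) (D : set 'cV[K]_n).

Lemma smooth_on_partial D f i : smooth_on D f -> smooth_on D (partial i f).
Proof. by move=> sf s; have := sf (rcons s i); rewrite /iter_partial foldr_rcons. Qed.

Lemma smooth_gradient D f : smooth_on D f -> gradient_on D f (grad f).
Proof.
by move=> sf x Dx i; have [_ /(_ i) df] := sf [::] x Dx; rewrite mxE; apply: DeriveDef.
Qed.

Lemma iter_partial_eq D f g s : open D -> (forall x, D x -> f x = g x) ->
  forall x, D x -> iter_partial s f x = iter_partial s g x.
Proof.
move=> oD fg; elim: s => [//|i s IH] x Dx /=.
apply: near_eq_derive; apply: filterS (open_nbhs_nbhs (conj oD Dx)) => y.
exact: IH.
Qed.

Lemma smooth_on_eq D f g : open D -> (forall x, D x -> f x = g x) ->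
  smooth_on D f -> smooth_on D g.
Proof.
move=> oD fg sf s x Dx; have [cf df] := sf s x Dx.
have E : \forall y \near x, iter_partial s f y = iter_partial s g y.
  apply: filterS (open_nbhs_nbhs (conj oD Dx)) => y; exact: iter_partial_eq.
split=> [|i]; last exact: near_eq_derivable (df i).
rewrite /prop_for /continuous_at -(iter_partial_eq s oD fg Dx).
exact: (cvg_trans (near_eq_cvg E) cf).
Qed.

Lemma smooth_on0 D : smooth_on D (fun=> 0).
Proof.
move=> s x _; have -> : iter_partial s (fun=> 0) = (fun _ : 'cV[K]_n => 0 : K).
  elim: s => [//|i s IH] /=; rewrite IH.
  by apply/funext => y; rewrite /partial -[fun=> 0]/(cst 0) derive_cst.
split=> [|i]; first exact: cst_continuous.
by apply: derivable_cst.
Qed.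

Lemma smooth_onDZ D f g c : open D -> smooth_on D f -> smooth_on D g ->
  smooth_on D (fun x => f x + c * g x).
Proof.
move=> oD sf sg.
have E s x : D x -> iter_partial s (fun x => f x + c * g x) x =
    iter_partial s f x + c * iter_partial s g x.
  elim: s x => [//|i s IH] x Dx /=.
  have -> : partial i (iter_partial s (fun x => f x + c * g x)) x
    = 'D_(delta_mx i 0) (iter_partial s f + c *: iter_partial s g) x.
    apply: near_eq_derive; apply: filterS (open_nbhs_nbhs (conj oD Dx)) => y.
    exact: IH.
  have [_ df] := sf s x Dx; have [_ dg] := sg s x Dx.
  by rewrite deriveD ?deriveZ//; apply: derivableZ.
move=> s x Dx; have [cf df] := sf s x Dx; have [cg dg] := sg s x Dx.
have N : \forall y \near x, (iter_partial s f + c *: iter_partial s g) y =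
   iter_partial s (fun x => f x + c * g x) y.
  by apply: filterS (open_nbhs_nbhs (conj oD Dx)) => y Dy; rewrite E.
split=> [|i].
  rewrite /prop_for /continuous_at (E s x Dx).
  apply: (cvg_trans (near_eq_cvg N)).
  by apply: cvgD => //; apply: cvgM => //; apply: cvg_cst.
apply: near_eq_derivable N _.
by apply: derivableD => //; apply: derivableZ.
Qed.

Lemma smooth_on_sum (I : Type) (r : seq I) D (f : I -> 'cV[K]_n -> K) (c : I -> K) :
  open D -> (forall i, smooth_on D (f i)) ->
  smooth_on D (fun x => \sum_(i <- r) c i * f i x).
Proof.
move=> oD sf; elim: r => [|i r IH].
  by under eq_fun do rewrite big_nil; apply: smooth_on0.
under eq_fun do rewrite big_cons addrC.
exact: smooth_onDZ.
Qed.

Context {R : realType} (iota : real_embedding R K).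

(** The partial derivatives of h are the components of F, so only continuity of h
    itself is left to prove, and it follows from the local boundedness of F. *)
Lemma smooth_on_primitive D h F : open D -> gradient_on D h F ->
  (forall i, smooth_on D (fun x => F x i 0)) -> smooth_on D h.
Proof.
move=> oD hF sF s x Dx; case/lastP: s => [|s i]; last first.
  rewrite /iter_partial foldr_rcons.
  apply: (smooth_on_eq oD _ (sF i)) => // y Dy.
  by have [_ <-] := hF y Dy i.
split=> [|i]; last by have [] := hF x Dx i.
have /nbhs_ballP[r /= r0 rD] := open_nbhs_nbhs (conj oD Dx).
have [|q q0 [M M0 HM]] := @locally_bounded _ _ _ (fun i y => F y i 0) x.
  by move=> i; have [] := sF i [::] x Dx.
have [p p0 [pr pq]] := pos_lower_bound r0 q0.
apply/(@cvgrPdist_le _ _ _ (nbhs x) (nbhs_filter x)) => e e0.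
have C1 : 0 < n%:R * M + 1 by rewrite ltr_wpDl// mulr_ge0.
have [d d0 [dp de]] := pos_lower_bound p0 (divr_gt0 e0 C1).
apply/nbhs_ballP; exists d => //= y xy.
rewrite distrC -(subrKC x y).
have bD z : box iota x (y - x) z -> ball x p z.
  move=> zb; apply: (box_in_ball _ _ zb); first exact: ballxx.
  by rewrite subrKC; apply: le_ball xy.
apply: le_trans (@mean_value_box _ _ iota _ _ F x (y - x) M M0 _ _) _.
- by apply: gradient_onS hF => z /bD zp; apply: rD; apply: le_ball zp.
- move=> z /bD; rewrite -ball_normE/= distrC => zp; apply: HM.
  exact: lt_le_trans pq.
rewrite mulrA; apply: (@le_trans _ _ ((n%:R * M + 1) * `|y - x|)).
  by rewrite ler_wpM2r// lerDl.
rewrite mulrC -ler_pdivlMr//; apply: le_trans de.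
by apply: ltW; move: xy; rewrite -ball_normE/= distrC.
Qed.

End Smooth.

Lemma smooth_schwarz (R : realType) (K : numFieldType)
    (iota : real_embedding R K) n D (f : 'cV[K]_n -> K) i j x :
    open D -> smooth_on D f -> D x ->
  partial i (partial j f) x = partial j (partial i f) x.
Proof.
move=> oD sf Dx.
have /nbhs_ballP[r /= r0 rD] := open_nbhs_nbhs (conj oD Dx).
have {}rD y : `|y - x| < r -> D y.
  by move=> yx; apply: rD; rewrite -ball_normE/= distrC.
have d k g y : smooth_on D g -> `|y - x| < r -> is_derive y (unit_vec k) g (partial k g y).
  move=> sg /rD Dy; by have [_ dg] := sg [::] y Dy; exact: (DeriveDef (dg k) erefl).
apply: (@schwarz R K iota n f (partial j f) (partial i f) (partial i (partial j f))
  (partial j (partial i f)) j i x r r0).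
- by move=> y; apply: d.
- by move=> y; apply: d.
- by move=> y; apply/d/smooth_on_partial.
- by move=> y; apply/d/smooth_on_partial.
- by have [] := sf [:: i; j] x Dx.
- by have [] := sf [:: j; i] x Dx.
Qed.

(** * Local primitives of smooth closed fields *)

(** The interval is enlarged so that the end points of the unit interval become
    interior points and the derivatives there are two-sided. *)
Lemma antiderivative (R : realType) (psi : R -> R) :
    (forall t : R, -1 <= t <= 2 -> {for t, continuous psi}) ->
  exists Phi : R -> R, forall t : R, 0 <= t <= 1 -> is_derive t 1 Phi (psi t).
Proof.
move=> cpsi.
have int_psi : lebesgue_measure.-integrable `[(-1 : R), 2] (EFin \o psi).
  apply: continuous_compact_integrable; first exact: segment_compact.
  apply: continuous_in_subspaceT => t /set_mem/= t12.
  by apply: cpsi; move: t12; rewrite in_itv.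
exists (fun x => \int[lebesgue_measure]_(t in `[(-1 : R), x]) psi t)%R.
move=> t /andP[t0 t1].
have [||| dPhi PhiE] := @continuous_FTC1_closed R psi (-1) t 2 _ int_psi.
- lra.
- lra.
- by apply: cpsi; lra.
by rewrite derive1E in PhiE; exact: (DeriveDef dPhi PhiE).
Qed.

Definition id_embedding (R : realType) : real_embedding R R.
Proof.
refine (@RealEmbedding R R (idfun : {rmorphism R -> R}) _ _) => [x y //|x _].
by exists x.
Defined.

(** The primitive is P x = integral over [0, 1] of the product of x - a with
    F (a + t (x - a)).  Instead of differentiating under the integral sign, the
    increment of P is compared with s F_i x through the function
    H t = Phi_x' t - Phi_x t - s t F_i (a + t (x - a)), where Phi_x is an
    antiderivative of the integrand: closedness of F makes the derivative of H a
    sum of Taylor remainders of order s^2, uniformly in t. *)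
Lemma local_primitive_real (R : realType) n D (F : 'cV[R]_n -> 'cV[R]_n) a :
    open D -> D a -> (forall i, smooth_on D (fun x => F x i 0)) ->
    (forall i j x, D x ->
      partial j (fun x => F x i 0) x = partial i (fun x => F x j 0) x) ->
  exists2 r : R, 0 < r & exists P, gradient_on (ball a r) P F.
Proof.
move=> oD Da sF symF.
pose f i (x : 'cV[R]_n) : R := F x i 0.
pose G i := grad (f i).
have GE i j x : G i x j 0 = partial j (f i) x by rewrite mxE.
have sG i j : smooth_on D (partial j (f i)) by apply/smooth_on_partial/sF.
have [r1 r10 [M1 M10 HM1]] := @locally_bounded _ _ _
  (fun ij : 'I_n * 'I_n => partial ij.2 (f ij.1)) a (fun ij => (sG ij.1 ij.2 [::] a Da).1).
have [r2 r20 [M2 M20 HM2]] := @locally_bounded _ _ _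
  (fun ij : 'I_n * 'I_n * 'I_n => partial ij.2 (partial ij.1.2 (f ij.1.1))) a
  (fun ij => (smooth_on_partial ij.2 (sG ij.1.1 ij.1.2) [::] Da).1).
have /nbhs_ballP[r3 /= r30 r3D] := open_nbhs_nbhs (conj oD Da).
have [r r0 [rr1 [rr2 rr3]]] : exists2 r : R, 0 < r & r <= r1 /\ r <= r2 /\ r <= r3.
  have [q q0 [q1 q2]] := pos_lower_bound r10 r20; have [p p0 [p1 p2]] := pos_lower_bound q0 r30.
  exists p => //; split; [exact: le_trans q1|split => //; exact: le_trans q2].
pose M := M1 + M2.
have M0 : 0 <= M by rewrite addr_ge0.
have ballE y q : ball a q y = (`|y - a| < q) :> Prop.
  by rewrite -ball_normE/= distrC.
have rD : ball a r `<=` D by move=> y ay; apply: r3D; apply: le_ball ay.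
have G1 y i j : ball a r y -> `|G i y j 0| <= M.
  rewrite ballE GE => yr; have := HM1 y (lt_le_trans yr rr1) (i, j).
  by move=> /le_trans; apply; rewrite lerDl.
pose G2 i j := grad (partial j (f i)).
have G2M i y j k : ball a r y -> `|G2 i j y k 0| <= M.
  rewrite ballE mxE => yr; have := HM2 y (lt_le_trans yr rr2) ((i, j), k).
  by move=> /le_trans; apply; rewrite lerDr.
have df i : gradient_on (ball a r) (f i) (G i).
  by apply: gradient_onS rD _; apply/smooth_gradient/sF.
have dG i j : gradient_on (ball a r) (fun x => G i x j 0) (G2 i j).
  have -> : (fun x => G i x j 0) = partial j (f i) by apply/funext => x; rewrite GE.
  by apply: gradient_onS rD _; apply/smooth_gradient/sG.
have taylor_f i z v : ball a r z -> ball a r (z + v) ->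
    `|f i (z + v) - f i z - \sum_j v j 0 * G i z j 0| <= n%:R * (n%:R * M * `|v|) * `|v|.
  move=> az azv.
  apply: (@taylor_bound R R (id_embedding R) n (f i) (G i) (G2 i) a r M) => //.
  by move=> y ay j k; apply: G2M.
have lip_f i z v : ball a r z -> ball a r (z + v) ->
    `|f i (z + v) - f i z| <= n%:R * (M * `|v|).
  move=> az azv.
  apply: (@mean_value_box R R (id_embedding R) n (f i) (G i)) => //.
    by apply: gradient_onS (df i) => y; apply: box_in_ball.
  by move=> y yb j; apply: G1; move: yb; apply: box_in_ball.
(* The radius r / 4 keeps w x t inside the ball of radius r for t in [-2, 3],
   that is, for t in the interval [-1, 2] of the antiderivative and |h| < 1. *)
pose w (x : 'cV[R]_n) (t : R) : 'cV[R]_n := a + t *: (x - a).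
have wr x t : `|x - a| < r / 4 -> -2 <= t <= 3 -> ball a r (w x t).
  move=> xa t23; rewrite ballE /w addrC addKr normrZ.
  have : `|t| <= 3 by rewrite ler_norml; lra.
  have : 0 <= `|x - a| by [].
  have : 0 <= `|t| by [].
  nra.
have dfw i (x : 'cV[R]_n) (t : R) : `|x - a| < r / 4 -> -1 <= t <= 2 ->
    is_derive t 1 (fun t : R => f i (w x t)) (\sum_j (x - a) j 0 * G i (w x t) j 0).
  move=> xa t12.
  apply: (@is_derive_quadratic R R R _ t 1 _ 1 (n%:R * (n%:R * M * `|x - a|) * `|x - a|)).
  - by [].
  - by rewrite !mulr_ge0.
  move=> h; rewrite ltr_norml => h1.
  have wE : w x (t + h *: 1) = w x t + h *: (x - a).
    by rewrite /w -addrA -scalerDl [h *: 1]mulr1.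
  have := @taylor_f i (w x t) (h *: (x - a)).
  rewrite -wE => H.
  have -> : h *: (\sum_j (x - a) j 0 * G i (w x t) j 0)
      = \sum_j (h *: (x - a)) j 0 * G i (w x t) j 0.
    by rewrite scaler_sumr; apply: eq_bigr => j _; rewrite !mxE [_ *: _]mulrA.
  apply: (le_trans (H _ _)).
  - by apply: wr => //; lra.
  - by apply: wr => //; rewrite [h *: 1]mulr1; lra.
  - by rewrite normrZ; lra.
pose phi x (t : R) : R := \sum_j (x - a) j 0 * f j (w x t).
have /choice[Phi HPhi] : forall x, exists Ph : R -> R, `|x - a| < r / 4 ->
    forall t : R, 0 <= t <= 1 -> is_derive t 1 Ph (phi x t).
  move=> x; have [xa|nxa] := pselect (`|x - a| < r / 4); last by exists (fun=> 0).
  have [t t12|Ph HPh] := @antiderivative R (phi x).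
    have -> : phi x = \sum_j (fun t : R => (x - a) j 0 * f j (w x t)).
      by apply/funext => u; rewrite fct_sumE.
    apply: differentiable_continuous; apply/derivable1_diffP.
    apply: derivable_sum => j; apply: derivableM; first exact: derivable_cst.
    by have [] := dfw j x t xa t12.
  by exists Ph.
pose P x := Phi x 1 - Phi x 0.
have r40 : 0 < r / 4 by rewrite divr_gt0.
exists (r / 4) => //; exists P => x; rewrite ballE => xa i.
pose q := r / 4 - `|x - a|.
pose C := \sum_j `|(x - a) j 0| * (n%:R * (n%:R * M)) + n%:R * M.
apply: (@is_derive_quadratic R _ _ _ x _ _ q C).
- by rewrite subr_gt0.
- by rewrite addr_ge0 ?mulr_ge0// sumr_ge0// => j _; rewrite !mulr_ge0.
move=> s sq; set x' := x + s *: unit_vec i.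
have us := norm_scale_unit_vec_le (n := n) i s.
have xa' : `|x' - a| < r / 4.
  rewrite /x' addrAC (le_lt_trans (ler_normD _ _))//.
  by move: sq; rewrite /q; lra.
have wx' t : w x' t = w x t + (t * s) *: unit_vec i.
  by rewrite /w /x' [x + _ - a]addrAC scalerDr scalerA addrA.
pose H t := Phi x' t - Phi x t - s * (t * f i (w x t)).
have -> : P x' - P x - s *: F x i 0 = H (0 + 1) - H 0.
  have -> : s *: F x i 0 = s * F x i 0 by [].
  rewrite /H add0r /P mul0r mulr0 mul1r.
  have -> : w x 1 = x by rewrite /w scale1r subrKC.
  by rewrite /f; ring.
pose dH t := phi x' t - phi x t
   - s * (f i (w x t) + t * (\sum_j (x - a) j 0 * G i (w x t) j 0)).
apply: (mean_value_ineq (iota := id_embedding R) (df := dH)) => t t01.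
rewrite /= add0r [t *: 1]mulr1.
have dfit := dfw i x t xa.
have awt : ball a r (w x t) by apply: wr => //; lra.
have awt' : ball a r (w x t + (t * s) *: unit_vec i).
  by rewrite -wx'; apply: wr => //; lra.
split.
  apply: is_deriveB; first by apply: is_deriveB; apply: HPhi.
  have -> : (fun t : R => s * (t * f i (w x t))) = s *: (fun t : R => t * f i (w x t)) by [].
  have -> : s * (f i (w x t) + t * (\sum_j (x - a) j 0 * G i (w x t) j 0)) =
    s *: (t *: (\sum_j (x - a) j 0 * G i (w x t) j 0) + f i (w x t) *: 1).
    by rewrite [s *: _]/(s * _) [t *: _]/(t * _) [_ *: 1]mulr1 addrC.
  apply: is_deriveZ.
  apply: (is_deriveM (is_derive_id _ _) (dfit _)); lra.
(* Closedness replaces the j-th derivative of F_i by the i-th of F_j. *)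
have -> : dH t = \sum_j (x - a) j 0 *
      (f j (w x t + (t * s) *: unit_vec i) - f j (w x t) - t * s * G j (w x t) i 0)
    + s * (f i (w x t + (t * s) *: unit_vec i) - f i (w x t)).
  rewrite /dH /phi wx'.
  have -> : \sum_j (x' - a) j 0 * f j (w x t + (t * s) *: unit_vec i)
    = \sum_j (x - a) j 0 * f j (w x t + (t * s) *: unit_vec i)
      + s * f i (w x t + (t * s) *: unit_vec i).
    have -> : x' - a = (x - a) + s *: unit_vec i by rewrite /x' addrAC.
    under eq_bigr do rewrite mxE mulrDl.
    rewrite big_split/=; congr (_ + _).
    rewrite (bigD1 i)//= !mxE !eqxx mulr1 big1 ?addr0// => j ji.
    by rewrite !mxE (negPf ji) mulr0 mul0r.
  under [X in _ = X + _]eq_bigr do rewrite mulrBr mulrBr.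
  rewrite !sumrB.
  have -> : \sum_j (x - a) j 0 * (t * s * G j (w x t) i 0) =
     t * s * (\sum_j (x - a) j 0 * G i (w x t) j 0).
    rewrite mulr_sumr; apply: eq_bigr => j _.
    by rewrite !GE symF; [ring|exact: rD].
  by ring.
have ts : `|(t * s) *: (unit_vec i : 'cV[R]_n)| <= `|s|.
  rewrite (le_trans (norm_scale_unit_vec_le i _))// normrM.
  by rewrite ler_piMl// ger0_norm; lra.
apply: le_trans (ler_normD _ _) _; rewrite mulrDl lerD//.
  rewrite mulr_suml (le_trans (ler_norm_sum _ _ _))// ler_sum// => j _.
  rewrite normrM -[X in _ <= X]mulrA ler_wpM2l//.
  have := @taylor_f j _ _ awt awt'.
  have eE k : ((t * s) *: unit_vec i) k 0 = t * s * (k == i)%:R.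
    by rewrite !mxE eqxx andbT.
  rewrite (bigD1 i)//= eE eqxx mulr1 big1 ?addr0; last first.
    by move=> k ki; rewrite eE (negPf ki) mulr0 mul0r.
  move=> T; apply: (le_trans T).
  by rewrite -!mulrA !ler_wpM2l// expr2 ler_pM.
rewrite normrM mulrC expr2 mulrA ler_wpM2r//.
by rewrite (le_trans (lip_f _ _ _ awt awt'))// mulrA ler_wpM2l// mulr_ge0.
Qed.

(** * Absolutely summable families of monomials *)

Section Summation.
Context {R : realType} {K : numFieldType} (iota : real_embedding R K).

Lemma sum_uniq_subset (I : eqType) (s1 s2 : seq I) (F : I -> K) :
    uniq s1 -> uniq s2 -> {subset s1 <= s2} ->
  \sum_(m <- s2) F m = \sum_(m <- s1) F m + \sum_(m <- s2 | m \notin s1) F m.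
Proof.
move=> u1 u2 s12; rewrite (bigID (mem s1))/=; congr (_ + _).
rewrite -big_filter; apply: perm_big; apply: uniq_perm => //.
  exact: filter_uniq.
move=> m; rewrite mem_filter; apply: andb_idr; exact: s12.
Qed.

Lemma sum_fset_sub (I : choiceType) (A A' : {fset I}) (F : I -> K) :
    (A `<=` A')%fset ->
  \sum_(m <- A') F m = \sum_(m <- A) F m + \sum_(m <- (A' `\` A)%fset) F m.
Proof.
move=> AA'; rewrite (@sum_uniq_subset _ A) ?fset_uniq//; last exact/fsubsetP.
congr (_ + _); rewrite -big_filter; apply: perm_big; apply: uniq_perm.
- by rewrite filter_uniq ?fset_uniq.
- exact: fset_uniq.
- by move=> m; rewrite mem_filter inE.
Qed.

Lemma cvg_norm_le (I : choiceType) (u : {fset I} -> K) (l C : K) :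
  (forall A, `|u A| <= C) -> u A @[A --> finite_subsets] --> l -> `|l| <= C.
Proof.
move=> uC /cvgrPdist_le ul; apply/ler_addgt0Pr => e e0.
have [A _ /(_ A (fsubset_refl _)) HA] := ul e e0.
rewrite -(subrK (u A) l) (le_trans (ler_normD _ _))// addrC lerD//.
Qed.

Lemma finite_sums_unique (I : choiceType) (u : {fset I} -> K) (l l' : K) :
  u A @[A --> finite_subsets] --> l -> u A @[A --> finite_subsets] --> l' -> l = l'.
Proof. exact: (@cvg_unique _ (@norm_hausdorff _ K)). Qed.

Hypothesis complete_K : forall F : set_system K, ProperFilter F -> cauchy F -> cvg F.

(** The bounded sums of absolute values have a real supremum; once a finite set
    nearly reaches it, the terms outside contribute little. *)
Lemma summable_cvg (I : choiceType) (u : I -> K) (C : K) :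
    (forall A : {fset I}, \sum_(m <- A) `|u m| <= C) ->
  exists l : K, (fun A : {fset I} => \sum_(m <- A) u m) @ finite_subsets --> l.
Proof.
move=> uC.
suff : cvg ((fun A : {fset I} => \sum_(m <- A) u m) @ finite_subsets) by move/cvg_ex.
have FF : ProperFilter ((fun A : {fset I} => \sum_(m <- A) u m) @ finite_subsets).
  exact: fmap_proper_filter.
apply: complete_K; apply/cauchy_exP => e e0.
have /choice[v uv] : forall m, exists v : R, `|u m| = iota v.
  by move=> m; have [v uv] := emb_onto iota (normr_ge0 (u m)); exists v.
have [C' CE] : exists C', C = iota C'.
  apply: (emb_onto iota); have := uC fset0; rewrite big_seq_fset0//.
have [e' e'0 eE] := emb_pos iota e0.
pose S : set R := [set \sum_(m <- enum_fset A) v m | A in [set: {fset I}]].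
have sumE (A : {fset I}) : \sum_(m <- A) `|u m| = iota (\sum_(m <- A) v m).
  by rewrite rmorph_sum; apply: eq_bigr => m _; rewrite uv.
have supS : has_sup S.
  split; first by exists (\sum_(m <- fset0) v m), fset0.
  by exists C' => _ [A _ <-]; have := uC A; rewrite sumE CE emb_le.
have [_ [A _ <-] HA] := sup_adherent e'0 supS.
exists (\sum_(m <- A) u m); exists A => // A' /= AA'.
rewrite -ball_normE/= (sum_fset_sub _ AA') opprD addrA subrr sub0r normrN.
apply: le_lt_trans (ler_norm_sum _ _ _) _.
rewrite sumE eE emb_lt.
have := sum_fset_sub (fun m => iota (v m)) AA'.
rewrite -!rmorph_sum -rmorphD => /(fmorph_inj _) E.
have : \sum_(m <- A') v m <= sup S by apply: ub_le_sup; [case: supS|exists A'].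
by rewrite E; lra.
Qed.

End Summation.

Section MultiIndex.
Context {K : numFieldType} {n : nat}.
Implicit Types (m : {ffun 'I_n -> nat}) (c : {ffun 'I_n -> nat} -> K)
  (h : 'cV[K]_n) (i j : 'I_n).

Definition deg m := (\sum_i m i)%N.

Definition incr_at i m : {ffun 'I_n -> nat} := [ffun j => (m j + (j == i))%N].

Definition decr_at i m : {ffun 'I_n -> nat} := [ffun j => (m j - (j == i))%N].

Lemma deg_incr_at i m : deg (incr_at i m) = (deg m).+1.
Proof.
rewrite /deg (eq_bigr (fun j => m j + (j == i))%N); last by move=> j _; rewrite ffunE.
by rewrite big_split/= -big_mkcond/= big_pred1_eq addn1.
Qed.

Lemma incr_atK i : cancel (incr_at i) (decr_at i).
Proof. by move=> m; apply/ffunP => j; rewrite !ffunE addnK. Qed.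

Lemma decr_atK i m : (0 < m i)%N -> incr_at i (decr_at i m) = m.
Proof.
move=> mi; apply/ffunP => j; rewrite !ffunE subnK//.
by case: eqP => [->|_].
Qed.

Lemma incr_at_gt0 i m : (0 < incr_at i m i)%N.
Proof. by rewrite ffunE eqxx addn1. Qed.

Lemma incr_atC i j m : incr_at i (incr_at j m) = incr_at j (incr_at i m).
Proof. by apply/ffunP => k; rewrite !ffunE addnAC. Qed.

Lemma leq_deg i m : (m i <= deg m)%N.
Proof. by rewrite /deg (bigD1 i)//= leq_addr. Qed.

Lemma deg_eq0 m : deg m = 0%N -> m = [ffun=> 0%N].
Proof.
move=> m0; apply/ffunP => i; rewrite ffunE; apply/eqP.
by rewrite -leqn0 -m0 leq_deg.
Qed.

Lemma prod_deg (x : K) m : \prod_i x ^+ m i = x ^+ deg m.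
Proof. by rewrite /deg prodrXr. Qed.

Lemma norm_monom_le h m (r : K) : `|h| <= r -> `|monom h m| <= r ^+ deg m.
Proof.
move=> hr; rewrite normr_prod -prod_deg; apply: ler_prod => i _.
rewrite normr_ge0 normrX lerXn2r ?nnegrE//; first exact: le_trans hr.
by rewrite (le_trans _ hr)// coord_le_norm.
Qed.

Lemma geometric_sum_le2 N : \sum_(l < N) (2^-1 : K) ^+ l <= 2.
Proof.
suff -> : \sum_(l < N) (2^-1 : K) ^+ l = 2 - 2 * 2^-1 ^+ N.
  by rewrite gerBl mulr_ge0// exprn_ge0// invr_ge0.
elim: N => [|N IH]; first by rewrite big_ord0 expr0 mulr1 subrr.
by rewrite big_ord_recr/= IH exprS; field.
Qed.

(** The finite set lies in a box of multi-indices, over which the sum is a product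
    of n geometric sums, each at most 2. *)
Lemma sum_half_deg_le (A : {fset {ffun 'I_n -> nat}}) :
  \sum_(m <- A) (2^-1 : K) ^+ deg m <= 2 ^+ n.
Proof.
pose N := (\sum_(m <- A) deg m).+1.
have AN m i : m \in A -> (m i < N)%N.
  move=> mA; rewrite ltnS (leq_trans (leq_deg i m))//.
  by rewrite (big_rem m)//= leq_addr.
pose F (k : {ffun 'I_n -> 'I_N}) : {ffun 'I_n -> nat} := [ffun i => (k i : nat)].
have F_inj : injective F.
  move=> k k' /ffunP E; apply/ffunP => i; apply: val_inj.
  by have := E i; rewrite !ffunE.
pose S := [seq F k | k <- enum {: {ffun 'I_n -> 'I_N}}].
have uS : uniq S by rewrite map_inj_uniq// enum_uniq.
have AS : {subset A <= S}.
  move=> m mA; apply/mapP; exists [ffun i => Ordinal (AN m i mA)].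
    by rewrite mem_enum.
  by apply/ffunP => i; rewrite !ffunE.
apply: (@le_trans _ _ (\sum_(m <- S) (2^-1 : K) ^+ deg m)).
  rewrite [X in _ <= X](@sum_uniq_subset _ _ A)// ?fset_uniq// lerDl.
  by apply: sumr_ge0 => m _; rewrite exprn_ge0// invr_ge0.
rewrite big_map big_enum/=.
have -> : \sum_(k : {ffun 'I_n -> 'I_N}) (2^-1 : K) ^+ deg (F k) =
    \sum_(k : {ffun 'I_n -> 'I_N}) \prod_i (2^-1 : K) ^+ k i.
  by apply: eq_bigr => k _; rewrite -prod_deg; apply: eq_bigr => i _; rewrite ffunE.
rewrite -(bigA_distr_bigA (fun _ (l : 'I_N) => (2^-1 : K) ^+ l)).
rewrite -[n in X in _ <= X]card_ord -prodr_const; apply: ler_prod => i _.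
by rewrite geometric_sum_le2 sumr_ge0// => l _; rewrite exprn_ge0// invr_ge0.
Qed.

(** Cauchy's estimate, which characterizes the coefficients of convergent power
    series and is stable under the operations below. *)
Definition geometric c := exists2 t : K, 0 < t &
  exists M : K, forall m, `|c m| * t ^+ deg m <= M.

Lemma geometric_bound c : geometric c -> exists2 t : K, 0 < t &
  exists2 M : K, 0 <= M & forall m, `|c m| * t ^+ deg m <= M.
Proof.
move=> [t t0 [M HM]]; exists t => //; exists M => //.
by apply: le_trans (HM [ffun=> 0%N]); rewrite mulr_ge0// exprn_ge0// ltW.
Qed.

Lemma geometric_shrink c (t t' M : K) : 0 < t' -> t' <= t ->
    (forall m, `|c m| * t ^+ deg m <= M) ->
  forall m, `|c m| * t' ^+ deg m <= M.
Proof.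
move=> t0 tt' H m; apply: le_trans (H m); rewrite ler_wpM2l//.
by rewrite lerXn2r ?nnegrE// ?ltW// (lt_le_trans t0).
Qed.

Lemma geometricDZ c c' (k : K) : geometric c -> geometric c' ->
  geometric (fun m => c m + k * c' m).
Proof.
move=> [t t0 [M HM]] [t' t'0 [M' HM']].
have [s s0 [st st']] := pos_lower_bound t0 t'0; exists s => //.
exists (M + `|k| * M') => m.
apply: (@le_trans _ _ ((`|c m| + `|k * c' m|) * s ^+ deg m)).
  by rewrite ler_wpM2r ?ler_normD// exprn_ge0// ltW.
rewrite mulrDl lerD ?(geometric_shrink s0 st HM)// normrM -mulrA ler_wpM2l//.
exact: (geometric_shrink s0 st' HM').
Qed.

Lemma geometric0 : geometric (fun=> 0).
Proof. by exists 1 => //; exists 0 => m; rewrite normr0 mul0r. Qed.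

Lemma geometric_sum (I : Type) (r : seq I) (k : I -> K)
    (c : I -> {ffun 'I_n -> nat} -> K) :
  (forall l, geometric (c l)) -> geometric (fun m => \sum_(l <- r) k l * c l m).
Proof.
move=> gc; elim: r => [|l r IH].
  by under eq_fun do rewrite big_nil; apply: geometric0.
by under eq_fun do rewrite big_cons addrC; apply: geometricDZ.
Qed.

(** The coefficients of the i-th partial derivative of the series. *)
Definition dcoef i c m : K := (m i).+1%:R * c (incr_at i m).

Lemma dcoefC i j c : dcoef i (dcoef j c) = dcoef j (dcoef i c).
Proof.
apply/funext => m; rewrite /dcoef incr_atC !mulrA; congr (_ * _).
rewrite !ffunE [j == i]eq_sym; case: eqVneq => [->//|_].
by rewrite !addn0 mulrC.
Qed.

(** Halving t absorbs the factor m_i + 1, which is at most 2 ^ deg m. *)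
Lemma geometric_dcoef i c : geometric c -> geometric (dcoef i c).
Proof.
move=> [t t0 [M HM]]; exists (t / 2); first by rewrite divr_gt0.
exists (M / t) => m.
rewrite ler_pdivlMr// /dcoef normrM normr_nat.
apply: le_trans (HM (incr_at i m)); rewrite deg_incr_at exprSr.
rewrite expr_div_n [leRHS]mulrA ler_wpM2r ?(ltW t0)//.
have -> : (m i).+1%:R * `|c (incr_at i m)| * (t ^+ deg m / 2 ^+ deg m) =
   `|c (incr_at i m)| * (t ^+ deg m) * ((m i).+1%:R / 2 ^+ deg m) by ring.
rewrite ler_piMr ?mulr_ge0 ?exprn_ge0 ?(ltW t0)//.
rewrite ler_pdivrMr ?exprn_gt0// mul1r -natrX ler_nat.
by apply: leq_trans (ltn_expl _ (ltnSn 1)) _; rewrite leq_exp2l ?leq_deg.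
Qed.

Lemma geometric_decr_at i c : geometric c ->
  geometric (fun m => if (0 < m i)%N then c (decr_at i m) else 0).
Proof.
move=> /geometric_bound[t t0 [M M0 HM]]; exists t => //; exists (M * t) => m.
case: ifP => mi; last by rewrite normr0 mul0r mulr_ge0// ltW.
rewrite -{2}(decr_atK mi) deg_incr_at exprSr mulrA ler_wpM2r// ltW//.
Qed.

End MultiIndex.

(** * Termwise differentiation of power series *)

Section PowerSeries.
Context {R : realType} {K : numFieldType} (iota : real_embedding R K) {n : nat}.
Hypothesis complete_K : forall F : set_system K, ProperFilter F -> cauchy F -> cvg F.
Implicit Types (m : {ffun 'I_n -> nat}) (c : {ffun 'I_n -> nat} -> K)
  (h a : 'cV[K]_n) (i j : 'I_n) (f : 'cV[K]_n -> K).

Definition sums c h (l : K) :=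
  (fun A : {fset {ffun 'I_n -> nat}} => \sum_(m <- A) c m * monom h m)
    @ finite_subsets --> l.

Lemma sums_unique c h l l' : sums c h l -> sums c h l' -> l = l'.
Proof. exact: finite_sums_unique. Qed.

Lemma sums0 h : sums (fun=> 0) h 0.
Proof.
rewrite /sums [X in X @ _](_ : _ = cst 0); first exact: cvg_cst.
by apply/funext => A; rewrite big1// => m _; rewrite mul0r.
Qed.

Lemma sumsDZ c c' h l l' (k : K) : sums c h l -> sums c' h l' ->
  sums (fun m => c m + k * c' m) h (l + k * l').
Proof.
move=> cl cl'; rewrite /sums.
rewrite [X in X @ _](_ : _ = (fun A : {fset _} => \sum_(m <- A) c m * monom h m +
    k * \sum_(m <- A) c' m * monom h m)).
  by apply: cvgD => //; apply: cvgM => //; apply: cvg_cst.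
apply/funext => A; rewrite mulr_sumr -big_split/=; apply: eq_bigr => m _.
by rewrite mulrDl mulrA.
Qed.

Lemma sums_sum (I : Type) (r : seq I) (k : I -> K)
    (c : I -> {ffun 'I_n -> nat} -> K) h (l : I -> K) :
  (forall q, sums (c q) h (l q)) ->
  sums (fun m => \sum_(q <- r) k q * c q m) h (\sum_(q <- r) k q * l q).
Proof.
move=> cl; elim: r => [|q r IH].
  by under eq_fun do rewrite big_nil; rewrite big_nil; apply: sums0.
by under eq_fun do rewrite big_cons addrC; rewrite big_cons addrC; apply: sumsDZ.
Qed.

Lemma sum_norm_le c (t M : K) h (A : {fset {ffun 'I_n -> nat}}) :
    0 < t -> 0 <= M -> (forall m, `|c m| * t ^+ deg m <= M) -> `|h| <= t / 2 ->
  \sum_(m <- A) `|c m * monom h m| <= M * 2 ^+ n.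
Proof.
move=> t0 M0 HM ht; apply: le_trans (ler_wpM2l M0 (sum_half_deg_le A)).
rewrite mulr_sumr; apply: ler_sum => m _.
rewrite normrM; apply: le_trans (ler_wpM2l (normr_ge0 _) (norm_monom_le m ht)) _.
by rewrite exprMn mulrA ler_wpM2r// exprn_ge0// invr_ge0.
Qed.

Lemma geometric_sums c : geometric c -> exists2 r : K, 0 < r &
  forall h, `|h| <= r -> exists l, sums c h l.
Proof.
move=> /geometric_bound[t t0 [M M0 HM]]; exists (t / 2); first by rewrite divr_gt0.
move=> h ht; apply: (summable_cvg iota complete_K (C := M * 2 ^+ n)) => A.
exact: sum_norm_le HM ht.
Qed.

(** Unconditional convergence makes the terms outside some finite set small. *)
Lemma sums_bounded c h l : sums c h l -> exists M : K, forall m, `|c m * monom h m| <= M.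
Proof.
move=> /cvgrPdist_le/(_ 1 ltr01)[A _ HA].
pose S := \sum_(m <- A) `|c m * monom h m|.
have S0 : 0 <= S by apply: sumr_ge0.
exists (S + (1 + 1)) => m; have [mA|mA] := boolP (m \in A).
  by rewrite /S (big_rem m)//= -addrA lerDl addr_ge0// sumr_ge0.
rewrite ler_wpDl//.
have H1 := HA A (fsubset_refl _).
have H2 := HA (m |` A)%fset (fsubsetU1 _ _).
rewrite big_fsetU1//= in H2.
rewrite -[c m * _](addrK (\sum_(k <- A) c k * monom h k)).
rewrite -[X in `|X|](subrKA l).
rewrite (le_trans (ler_normD _ _))// lerD//.
by rewrite distrC.
Qed.

Definition has_expansion f a c := \forall h \near (0 : 'cV[K]_n), sums c h (f (a + h)).

Lemma near0P (P : 'cV[K]_n -> Prop) :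
  (\forall h \near (0 : 'cV[K]_n), P h) <-> exists2 r : K, 0 < r & forall h, `|h| < r -> P h.
Proof.
split=> [/nbhs_ballP[r /= r0 Hr]|[r r0 Hr]].
  by exists r => // h hr; apply: Hr; rewrite -ball_normE/= sub0r normrN.
apply/nbhs_ballP; exists r => // h; rewrite -ball_normE/= sub0r normrN; exact: Hr.
Qed.

(** Evaluation at a point whose coordinates all equal r / 2 turns the monomials
    into powers of r / 2. *)
Lemma has_expansion_geometric f a c : has_expansion f a c -> geometric c.
Proof.
move=> /near0P[r r0 Hr].
have t0 : 0 < r / 2 by rewrite divr_gt0.
have [|M HM] := sums_bounded (Hr (const_mx (r / 2)) _).
  apply: norm_ltP => // i; rewrite mxE gtr0_norm// ltr_pdivrMr//.
  by rewrite ltr_pMr// ltr1n.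
exists (r / 2) => //; exists M => m; have := HM m.
rewrite normrM; suff -> : monom (const_mx (r / 2)) m = (r / 2) ^+ deg m.
  by rewrite [X in _ * X]ger0_norm// exprn_ge0// ltW.
by rewrite /monom -prod_deg; apply: eq_bigr => i _; rewrite mxE.
Qed.

(** The second-order remainder of a power.  Multiplying by r ^ 2 avoids the
    exponent k - 2; the binomial coefficients sum to at most 4 ^ k, and this weaker
    constant is preserved by the induction. *)
Lemma taylor_pow (x s r : K) k : `|x| <= r -> `|s| <= r ->
  r ^+ 2 * `|(x + s) ^+ k - x ^+ k - s * (k%:R * x ^+ k.-1)| <= `|s| ^+ 2 * (4 * r) ^+ k.
Proof.
move=> xr sr; have r0 : 0 <= r by apply: le_trans xr.
elim: k => [|k IH].
  rewrite !expr0 mul0r mulr0 subrr subr0 normr0 mulr0 mulr1 exprn_ge0//.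
set E := (X in `|X|) in IH.
have -> : (x + s) ^+ k.+1 - x ^+ k.+1 - s * (k.+1%:R * x ^+ k.+1.-1) =
    (x + s) * E + s ^+ 2 * (k%:R * x ^+ k.-1).
  rewrite /E /= !exprS -natr1; case: (k) => [|k']; first by rewrite !expr0; ring.
  by rewrite /= !exprS; ring.
apply: (@le_trans _ _ ((r + r) * (r ^+ 2 * `|E|) + `|s| ^+ 2 * (k%:R * r ^+ k.+1))).
  have -> : (r + r) * (r ^+ 2 * `|E|) + `|s| ^+ 2 * (k%:R * r ^+ k.+1)
     = r ^+ 2 * ((r + r) * `|E| + `|s| ^+ 2 * (k%:R * r ^+ k.-1)).
    case: (k) => [|k']; first by rewrite !mul0r !mulr0; ring.
    by rewrite /= !exprS; ring.
  rewrite ler_wpM2l ?exprn_ge0// (le_trans (ler_normD _ _))// lerD//.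
    by rewrite normrM ler_wpM2r// (le_trans (ler_normD _ _))// lerD.
  rewrite normrM normrX normrM normr_nat normrX ler_wpM2l ?exprn_ge0//.
  by rewrite ler_wpM2l// lerXn2r ?nnegrE.
apply: (@le_trans _ _ ((r + r) * (`|s| ^+ 2 * (4 * r) ^+ k) + `|s| ^+ 2 * (4 ^+ k * r ^+ k.+1))).
  apply: lerD; first by rewrite ler_wpM2l// addr_ge0.
  rewrite ler_wpM2l ?exprn_ge0// ler_wpM2r ?exprn_ge0//.
  by rewrite -natrX ler_nat ltnW// ltn_expl.
have -> : (r + r) * (`|s| ^+ 2 * (4 * r) ^+ k) + `|s| ^+ 2 * (4 ^+ k * r ^+ k.+1)
   = `|s| ^+ 2 * (4 * r) ^+ k.+1 - `|s| ^+ 2 * (4 ^+ k * r ^+ k.+1).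
  by rewrite !exprMn !exprS; ring.
by rewrite gerBl !mulr_ge0// exprn_ge0.
Qed.

(** The i-th partial derivative of the monomial m. *)
Definition dmonom i h m : K :=
  (m i)%:R * h i 0 ^+ (m i).-1 * \prod_(j | j != i) h j 0 ^+ m j.

Lemma monomD1 i h m :
  monom h m = h i 0 ^+ m i * \prod_(j | j != i) h j 0 ^+ m j.
Proof. by rewrite /monom (bigD1 i). Qed.

Lemma taylor_monom i h (s r : K) m : `|h| <= r -> `|s| <= r ->
  r ^+ 2 * `|monom (h + s *: unit_vec i) m - monom h m - s * dmonom i h m|
    <= `|s| ^+ 2 * (4 * r) ^+ deg m.
Proof.
move=> hr sr; have r0 : 0 <= r by apply: le_trans sr.
have hi j : `|h j 0| <= r by rewrite (le_trans (coord_le_norm _ _)).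
rewrite !(monomD1 i) -prod_deg [X in _ <= _ * X](bigD1 i)//=.
have -> : (h + s *: unit_vec i) i 0 = h i 0 + s by rewrite !mxE !eqxx mulr1.
have -> : \prod_(j | j != i) (h + s *: unit_vec i) j 0 ^+ m j
    = \prod_(j | j != i) h j 0 ^+ m j.
  by apply: eq_bigr => j ji; rewrite !mxE (negPf ji) mulr0 addr0.
rewrite /dmonom; set Q := \prod_(j | _) h j 0 ^+ m j.
have -> : (h i 0 + s) ^+ m i * Q - h i 0 ^+ m i * Q
    - s * ((m i)%:R * h i 0 ^+ (m i).-1 * Q) =
  ((h i 0 + s) ^+ m i - h i 0 ^+ m i - s * ((m i)%:R * h i 0 ^+ (m i).-1)) * Q by ring.
rewrite normrM [leLHS]mulrA [leRHS]mulrA.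
apply: ler_pM => //; [by rewrite mulr_ge0 ?exprn_ge0|exact: taylor_pow|].
rewrite /Q normr_prod; apply: ler_prod => j _; rewrite normr_ge0/= normrX.
rewrite lerXn2r ?nnegrE ?mulr_ge0// (le_trans (hi j))// ler_peMl// ler1n//.
Qed.

(** The exponents of the monomials that remain after differentiation in the i-th
    variable of those with exponents in A. *)
Definition shrink i (A : {fset {ffun 'I_n -> nat}}) : {fset {ffun 'I_n -> nat}} :=
  [fset decr_at i m | m in [fset m in A | (0 < m i)%N]]%fset.

Lemma sum_shrink i c h (A : {fset {ffun 'I_n -> nat}}) :
  \sum_(m <- shrink i A) dcoef i c m * monom h m = \sum_(m <- A) c m * dmonom i h m.
Proof.
rewrite /shrink big_imfset/=; last first.
  move=> m m'; rewrite !inE/= => /andP[_ mi] /andP[_ m'i] E.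
  by rewrite -(decr_atK mi) E decr_atK.
rewrite [RHS](bigID (fun m : {ffun 'I_n -> nat} => (0 < m i)%N))/=.
rewrite [X in _ = _ + X]big1 ?addr0; last first.
  by move=> m; rewrite -eqn0Ngt => /eqP mi; rewrite /dmonom mi !mul0r mulr0.
rewrite -[RHS]big_filter.
have P : perm_eq [fset m in A | (0 < m i)%N]%fset [seq m : {ffun 'I_n -> nat} <- A | (0 < m i)%N].
  apply: uniq_perm; [exact: fset_uniq|by rewrite filter_uniq ?fset_uniq|].
  by move=> m; rewrite !inE mem_filter andbC.
rewrite (perm_big _ P)/= [LHS]big_filter [RHS]big_filter; apply: eq_bigr => m mi.
rewrite /dcoef decr_atK// ffunE eqxx subn1 prednK// /dmonom /monom (bigD1 i)//=.
rewrite ffunE eqxx subn1.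
have -> : \prod_(j | j != i) h j 0 ^+ (decr_at i m) j = \prod_(j | j != i) h j 0 ^+ m j.
  by apply: eq_bigr => j ji; rewrite ffunE (negPf ji) subn0.
by ring.
Qed.

(** Finite sets containing the images under [incr_at i] of a given finite set
    shrink to sets containing it, so the differentiated sums form a subnet of the
    partial sums of the derived series. *)
Lemma sums_dmonom i c h l : sums (dcoef i c) h l ->
  (fun A : {fset {ffun 'I_n -> nat}} => \sum_(m <- A) c m * dmonom i h m)
    @ finite_subsets --> l.
Proof.
move=> cl.
rewrite [X in X @ _](_ : _ = (fun A : {fset {ffun 'I_n -> nat}} =>
    \sum_(m <- shrink i A) dcoef i c m * monom h m)); last first.
  by apply/funext => A; rewrite sum_shrink.
apply: (cvg_comp (shrink i) _ _ cl) => P [A0 _ HA0].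
exists [fset incr_at i m | m in A0]%fset => // A /= A0A; apply: HA0 => /=.
apply/fsubsetP => m mA0; apply/imfsetP; exists (incr_at i m); rewrite ?incr_atK//=.
rewrite !inE/= incr_at_gt0 andbT; move/fsubsetP: A0A; apply.
by apply/imfsetP; exists m.
Qed.

(** Summing [taylor_monom] bounds the remainder of every finite partial sum by
    the same multiple of the square of s; the bound passes to the limit. *)
Lemma has_expansion_derive f a c i : has_expansion f a c ->
  \forall h \near (0 : 'cV[K]_n), exists2 l : K,
    is_derive (a + h) (unit_vec i) f l & sums (dcoef i c) h l.
Proof.
move=> fc; have gc := has_expansion_geometric fc.
have [t t0 [M M0 HM]] := geometric_bound gc.
have [q q0 Hq] := geometric_sums (geometric_dcoef i gc).
move/near0P: fc => [p p0 Hp].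
(* With this r, the factor 4 r of the remainder is t / 2, so that the bounds of
   the terms are summable by [sum_half_deg_le]. *)
pose r := t / 8.
have r0 : 0 < r by rewrite divr_gt0.
have [u u0 [ur [uq up2]]] : exists2 u : K, 0 < u & u <= r /\ u <= q /\ u <= p / 2.
  have [u1 u10 [u11 u12]] := pos_lower_bound r0 q0.
  have [u u0 [uu1 up2]] := pos_lower_bound u10 (divr_gt0 p0 (ltr0Sn K 1)).
  by exists u => //; split; [exact: le_trans u11|split => //; exact: le_trans u12].
have p2p : p / 2 < p by rewrite ltr_pdivrMr// ltr_pMr// ltr1n.
apply/near0P; exists u => // h hu.
have [l Hl] := Hq h (le_trans (ltW hu) uq).
exists l => //.
pose C := M * 2 ^+ n / r ^+ 2.
apply: (@is_derive_quadratic _ _ _ _ _ _ _ u C) => //.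
  by rewrite divr_ge0// ?exprn_ge0// ?mulr_ge0// ?exprn_ge0// ltW.
move=> s su.
have hp : `|h| < p by rewrite (lt_le_trans hu)// (le_trans up2)// ltW.
have hsp : `|h + s *: unit_vec i| < p.
  rewrite (le_lt_trans (ler_normD _ _))// [p]splitr ltrD//.
    exact: lt_le_trans up2.
  by rewrite (le_lt_trans (norm_scale_unit_vec_le _ _))// (lt_le_trans su).
have := Hp _ hsp; rewrite addrA => S1.
have S0 := Hp _ hp.
have Sd := sums_dmonom Hl.
pose E (A : {fset {ffun 'I_n -> nat}}) := \sum_(m <- A)
  c m * (monom (h + s *: unit_vec i) m - monom h m - s * dmonom i h m).
have Ecvg : E A @[A --> finite_subsets] --> f (a + h + s *: unit_vec i) - f (a + h) - s * l.
  rewrite [X in X @ _](_ : _ = (fun A : {fset _} =>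
     \sum_(m <- A) c m * monom (h + s *: unit_vec i) m
     - \sum_(m <- A) c m * monom h m - s * \sum_(m <- A) c m * dmonom i h m)).
    by apply: cvgB; [exact: cvgB|apply: cvgM => //; exact: cvg_cst].
  apply/funext => A; rewrite mulr_sumr -!sumrB; apply: eq_bigr => m _.
  by ring.
apply: cvg_norm_le Ecvg => A.
rewrite /C mulrAC ler_pdivlMr ?exprn_gt0// mulrC.
rewrite (le_trans (ler_wpM2l _ (ler_norm_sum _ _ _)))// ?exprn_ge0 ?(ltW r0)//.
rewrite mulr_sumr -mulrA mulrCA mulrC -mulrA [X in _ <= _ * X]mulrC.
apply: (@le_trans _ _ (\sum_(m <- A) M * (2^-1 ^+ deg m * `|s| ^+ 2))).
  apply: ler_sum => m _; rewrite normrM mulrCA.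
  have H := @taylor_monom i h s r m (le_trans (ltW hu) ur) (le_trans (ltW su) ur).
  apply: le_trans (ler_wpM2l (normr_ge0 _) H) _.
  have -> : 4 * r = t * 2^-1 by rewrite /r; field.
  rewrite exprMn [X in _ * X <= _]mulrC !mulrA ler_wpM2r ?exprn_ge0//.
  by rewrite ler_wpM2r// ler_wpM2r// exprn_ge0// invr_ge0.
rewrite -mulr_sumr -mulr_suml ler_wpM2l// ler_wpM2r ?exprn_ge0//.
exact: sum_half_deg_le.
Qed.

End PowerSeries.

(** * Local primitives of analytic closed fields *)

Section AnalyticPrimitive.
Context {R : realType} {K : numFieldType} (iota : real_embedding R K) {n : nat}.
Hypothesis complete_K : forall F : set_system K, ProperFilter F -> cauchy F -> cvg F.
Implicit Types (m : {ffun 'I_n -> nat}) (c : {ffun 'I_n -> nat} -> K)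
  (h a : 'cV[K]_n) (i j : 'I_n) (f g : 'cV[K]_n -> K).

Lemma sums_at0 c : sums c 0 (c [ffun=> 0%N]).
Proof.
apply: cvg_near_cst; exists [fset [ffun=> 0%N]]%fset => // A /= /fsubsetP A0.
have mA : [ffun=> 0%N] \in A by apply: A0; rewrite inE.
rewrite (bigD1_seq [ffun=> 0%N]) ?fset_uniq//= [X in _ * X]big1 ?mulr1; last first.
  by move=> i _; rewrite ffunE expr0.
rewrite big1 ?addr0// => m m0.
have [i mi] : exists i, (0 < m i)%N.
  apply/existsP; apply: contraNT m0 => /existsPn H; apply/eqP/ffunP => i.
  by rewrite ffunE; apply/eqP; rewrite eqn0Ngt H.
by rewrite (monomD1 i) mxE expr0n eqn0Ngt mi/= !mul0r mulr0.
Qed.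

Lemma has_expansion_partial f a c i : has_expansion f a c ->
  has_expansion (partial i f) a (dcoef i c).
Proof.
move=> /(has_expansion_derive iota complete_K i); apply: filterS => h [l [_ dl] cl].
by rewrite /partial dl.
Qed.

(** Evaluation at the centre gives the constant coefficient, and each further
    coefficient is a constant coefficient of a repeated derivative. *)
Lemma has_expansion_eq0 a c m : has_expansion (fun=> 0) a c -> c m = 0.
Proof.
move Ed : (deg m) => d; elim: d c m Ed => [|d IH] c m Ed c0.
  rewrite (deg_eq0 Ed). apply: (sums_unique (@sums_at0 c)).
  exact: (nbhs_singleton c0).
have [i mi] : exists i, (0 < m i)%N.
  apply/existsP; move/eqP: Ed; apply: contraTT => /existsPn H.
  by rewrite /deg big1// => i _; apply/eqP; rewrite eqn0Ngt H.
have : dcoef i c (decr_at i m) = 0.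
  apply: IH; first by apply: succn_inj; rewrite -(deg_incr_at i) decr_atK.
  have := has_expansion_partial i c0; congr has_expansion.
  by apply/funext => x; rewrite /partial -[fun=> 0]/(cst 0) derive_cst.
rewrite /dcoef decr_atK// => /eqP; rewrite mulf_eq0 pnatr_eq0/=.
by move/eqP.
Qed.

Lemma has_expansion_unique f g a c c' :
    (\forall h \near (0 : 'cV[K]_n), f (a + h) = g (a + h)) ->
    has_expansion f a c -> has_expansion g a c' -> c = c'.
Proof.
move=> fg fc gc'; apply/funext => m; apply/eqP; rewrite -subr_eq0; apply/eqP.
rewrite -[- c' m]mulN1r.
apply: (@has_expansion_eq0 a (fun m => c m + (-1) * c' m)).
near=> h.
have -> : 0 = f (a + h) + (-1) * g (a + h).
  have -> : f (a + h) = g (a + h) by near: h.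
  by rewrite mulN1r subrr.
by apply: sumsDZ; near: h.
Unshelve. all: by end_near.
Qed.

Lemma has_expansion_sum (I : finType) (k : I -> K) (f : I -> 'cV[K]_n -> K) a
    (c : I -> {ffun 'I_n -> nat} -> K) : (forall q, has_expansion (f q) a (c q)) ->
  has_expansion (fun x => \sum_q k q * f q x) a (fun m => \sum_q k q * c q m).
Proof.
move=> fc; have : \forall h \near (0 : 'cV[K]_n), forall q, sums (c q) h (f q (a + h)).
  exact: (@filter_forall _ I (fun q => [set h | sums (c q) h (f q (a + h))])
    (nbhs (0 : 'cV[K]_n)) _ fc).
by apply: filterS => h H; apply: sums_sum.
Qed.

Lemma dcoef_sum (I : finType) (k : I -> K) (c : I -> {ffun 'I_n -> nat} -> K) i :
  dcoef i (fun m => \sum_q k q * c q m) = (fun m => \sum_q k q * dcoef i (c q) m).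
Proof.
apply/funext => m; rewrite /dcoef mulr_sumr; apply: eq_bigr => q _.
by rewrite mulrCA.
Qed.

(** Euler's formula: the primitive of the homogeneous part of degree d - 1 of a
    closed field phi is 1/d times the sum of the x_i phi_i. *)
Definition primitive_coef (phi : 'I_n -> {ffun 'I_n -> nat} -> K) m : K :=
  (deg m)%:R^-1 * \sum_i (if (0 < m i)%N then phi i (decr_at i m) else 0).

Lemma dcoef_primitive_coef (phi : 'I_n -> {ffun 'I_n -> nat} -> K) k :
    (forall i j, dcoef i (phi j) = dcoef j (phi i)) ->
  dcoef k (primitive_coef phi) = phi k.
Proof.
move=> phiC; apply/funext => m; rewrite /dcoef /primitive_coef mulrCA mulr_sumr.
have E i : (m k).+1%:R * (if (0 < incr_at k m i)%N then phi i (decr_at i (incr_at k m)) else 0) =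
    (incr_at k m i)%:R * phi k m.
  have [->|ik] := eqVneq i k; first by rewrite incr_at_gt0 incr_atK ffunE eqxx addn1.
  have -> : incr_at k m i = m i by rewrite ffunE (negPf ik) addn0.
  case: ifP => mi; last first.
    by move/negbT: mi; rewrite -eqn0Ngt => /eqP ->; rewrite mul0r mulr0.
  have := congr1 (fun c => c (decr_at i m)) (phiC k i); rewrite /dcoef.
  rewrite decr_atK//.
  have -> : incr_at k (decr_at i m) = decr_at i (incr_at k m).
    by rewrite -{2}(decr_atK mi) incr_atC incr_atK.
  have -> : decr_at i m k = m k by rewrite ffunE eq_sym (negPf ik) subn0.
  by have -> : (decr_at i m i).+1 = m i by rewrite ffunE eqxx subn1 prednK.
rewrite (eq_bigr _ (fun i _ => E i)) -mulr_suml -natr_sum -/(deg _) deg_incr_at.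
by rewrite mulrA mulVf ?mul1r// pnatr_eq0.
Qed.

Lemma geometric_primitive_coef (phi : 'I_n -> {ffun 'I_n -> nat} -> K) :
  (forall i, geometric (phi i)) -> geometric (primitive_coef phi).
Proof.
move=> gphi.
have : geometric (fun m => \sum_i 1 * (if (0 < m i)%N then phi i (decr_at i m) else 0)).
  by apply: geometric_sum => i; apply: geometric_decr_at.
move=> [t t0 [M HM]]; exists t => //; exists M => m; apply: le_trans (HM m).
rewrite ler_wpM2r ?exprn_ge0 ?(ltW t0)// /primitive_coef normrM.
under [X in _ <= `|X|]eq_bigr do rewrite mul1r.
rewrite ler_piMl// normfV normr_nat; case: (deg m) => [|d]; first by rewrite invr0.
by rewrite invf_le1 ?ltr0Sn// ler1n.
Qed.

Lemma geometric_expansion c a : geometric c ->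
  exists f, has_expansion f a c.
Proof.
move=> /(geometric_sums iota complete_K)[r r0 Hr].
have /choice[f Hf] : forall x, exists l, `|x - a| <= r -> sums c (x - a) l.
  move=> x; have [xa|nxa] := pselect (`|x - a| <= r); last by exists 0.
  by have [l Hl] := Hr _ xa; exists l.
exists f; apply/near0P; exists r => // h hr.
by have := Hf (a + h); rewrite addrC addKr; apply; apply: ltW.
Qed.

(** By uniqueness of coefficients the equation grad f = B grad g passes to the
    series, where it makes the coefficients of B grad f closed as in the Hessian
    computation; then [primitive_coef] integrates them. *)
Lemma analytic_local_primitive (B : 'M[K]_n) f g a :
    analytic_at f a -> analytic_at g a ->
    (\forall h \near (0 : 'cV[K]_n), grad f (a + h) = B *m grad g (a + h)) ->
  exists2 r : K, 0 < r & exists2 P, analytic_at P a &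
    gradient_on (ball a r) P (fun x => B *m grad f x).
Proof.
move=> [c fc] [b gb] fBg.
have fc' : has_expansion f a c := fc.
have gb' : has_expansion g a b := gb.
have gc := has_expansion_geometric fc'.
have cb i : dcoef i c = (fun m => \sum_j B i j * dcoef j b m).
  apply: (@has_expansion_unique (partial i f) (fun x => \sum_j B i j * partial j g x) a).
  - apply: filterS fBg => h /matrixP/(_ i 0); rewrite !mxE => ->.
    by apply: eq_bigr => j _; rewrite mxE.
  - exact: has_expansion_partial.
  - by apply: has_expansion_sum => j; apply: has_expansion_partial.
pose phi i m := \sum_j B i j * dcoef j c m.
have phiC i k : dcoef i (phi k) = dcoef k (phi i).
  (* The entry (q, p) of B H B^T, for the Hessian H of the series of g. *)
  have E p q : dcoef p (phi q) =
      (fun m => \sum_j \sum_l B q j * (B p l * dcoef j (dcoef l b) m)).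
    rewrite /phi dcoef_sum; apply/funext => m; apply: eq_bigr => j _.
    rewrite dcoefC cb dcoef_sum mulr_sumr; by [].
  rewrite !E; apply/funext => m; rewrite exchange_big/=.
  apply: eq_bigr => j _; apply: eq_bigr => l _.
  by rewrite dcoefC mulrCA.
have gphi i : geometric (phi i).
  by apply: geometric_sum => j; apply: geometric_dcoef.
have [P HP] := geometric_expansion a (geometric_primitive_coef gphi).
have HF k : has_expansion (fun x => (B *m grad f x) k 0) a (phi k).
  have := @has_expansion_sum _ (fun j => B k j) (fun j => partial j f) a
    (fun j => dcoef j c) (fun j => has_expansion_partial j fc').
  congr has_expansion; apply/funext => x; rewrite mxE.
  by apply: eq_bigr => j _; rewrite mxE.
have : \forall h \near (0 : 'cV[K]_n), forall k,
    is_derive (a + h) (unit_vec k) P ((B *m grad f (a + h)) k 0).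
  apply: (@filter_forall _ _ (fun k => [set h : 'cV[K]_n |
     is_derive (a + h) (unit_vec k) P ((B *m grad f (a + h)) k 0)])
     (nbhs (0 : 'cV[K]_n))) => k.
  apply: filterS2 (HF k) (has_expansion_derive iota complete_K k HP) => h Fh [l dP Pl].
  rewrite dcoef_primitive_coef// in Pl.
  by rewrite /= (sums_unique Fh Pl).
move=> /near0P[r r0 Hr]; exists r => //; exists P; first by exists (primitive_coef phi).
move=> x; rewrite -ball_normE/= distrC => xa k.
by have := Hr _ xa k; rewrite subrKC.
Qed.

Lemma analytic_gradient D f : analytic_on D f -> gradient_on D f (grad f).
Proof.
move=> fD x /fD[c fc] i.
have [l] := nbhs_singleton (has_expansion_derive iota complete_K i fc).
by rewrite addr0 => -[dl fl] _; apply: DeriveDef => //; rewrite mxE.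
Qed.

Lemma analytic_at_eq f g a : {near a, f =1 g} -> analytic_at f a -> analytic_at g a.
Proof.
move=> fg [c fc]; exists c.
have : \forall h \near (0 : 'cV[K]_n), f (a + h) = g (a + h).
  by apply/near0P; move: fg => /nbhs_ballP[r /= r0 Hr]; exists r => // h hr;
    apply: Hr; rewrite -ball_normE/= opprD addrA subrr sub0r normrN.
by move=> E; apply: filterS2 E fc => h <-.
Qed.

Lemma analytic_at_addc f a (k : K) : analytic_at f a -> analytic_at (fun x => f x + k) a.
Proof.
move=> [c fc]; exists (fun m => c m + k * (m == [ffun=> 0%N])%:R).
apply: filterS fc => h fh; rewrite -[X in _ --> f _ + X]mulr1.
apply: sumsDZ => //; apply: cvg_near_cst.
exists [fset [ffun=> 0%N]]%fset => // A /= /fsubsetP A0.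
have mA : [ffun=> 0%N] \in A by apply: A0; rewrite inE.
rewrite (bigD1_seq [ffun=> 0%N]) ?fset_uniq//= eqxx mul1r [monom _ _]big1; last first.
  by move=> i _; rewrite ffunE expr0.
by rewrite big1 ?addr0// => m /negPf ->; rewrite mul0r.
Qed.

End AnalyticPrimitive.

(** * One integration step over either field *)

Section ComplexScalars.
Variable R : realType.
Local Open Scope complex_scope.

Definition complex_embedding : real_embedding R R[i].
Proof.
refine (@RealEmbedding R R[i] (real_complex R : {rmorphism R -> R[i]}) _ _).
  by move=> x y /=; rewrite lecR.
by move=> x x0; exists (complex.Re x); rewrite /= RRe_real// ger0_real.
Defined.

Lemma norm_Re_le (x : R[i]) : `|complex.Re x|%:C <= `|x|.
Proof. exact: normc_ge_Re. Qed.

Lemma norm_Im_le (x : R[i]) : `|complex.Im x|%:C <= `|x|.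
Proof.
have := norm_Re_le (x * 'i%C); rewrite ReiNIm normrN normrM.
suff -> : `|'i%C : R[i]| = 1 by rewrite mulr1.
by rewrite normc_def/= expr0n expr1n add0r sqrtr1.
Qed.

Lemma norm_le_Re_Im (x : R[i]) : `|x| <= (`|complex.Re x| + `|complex.Im x|)%:C.
Proof.
rewrite {1}[x]complexE (le_trans (ler_normD _ _))// rmorphD lerD//.
  by rewrite normc_def/= expr0n addr0 sqrtr_sqr.
rewrite normrM !normc_def/= !expr0n expr1n add0r addr0 sqrtr1 mul1r.
by rewrite sqrtr_sqr.
Qed.

(** Cauchy filters converge because their real and imaginary parts do. *)
Lemma complex_complete (F : set_system (scalars R ComplexCase)) :
  ProperFilter F -> cauchy F -> cvg F.
Proof.
move=> FF /cauchyP Fc.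
have part (p : scalars R ComplexCase -> R) : (forall x y, p (x - y) = p x - p y) ->
    (forall x, `|p x|%:C <= `|x|) -> cvg (p @ F).
  move=> pB pn; apply: R_complete; apply/cauchy_exP => e e0.
  have [|x Fx] := Fc e%:C; first by rewrite ltcR.
  exists (p x); suff : F [set y | ball (p x) e (p y)] by [].
  apply: filterS Fx => y; rewrite /= -!ball_normE/= => xy.
  by rewrite -pB -ltcR; apply: le_lt_trans xy; apply: pn.
have /cvg_ex[lre Hre] : cvg ((@complex.Re R : scalars R ComplexCase -> R) @ F).
  by apply: part; [move=> [? ?] [? ?]|exact: norm_Re_le].
have /cvg_ex[lim Him] : cvg ((@complex.Im R : scalars R ComplexCase -> R) @ F).
  by apply: part; [move=> [? ?] [? ?]|exact: norm_Im_le].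
apply/cvg_ex; exists (lre +i* lim); apply/cvgrPdist_le => e e0.
have [e' e'0 ->] := emb_pos complex_embedding e0.
have e2 : 0 < e' / 2 by rewrite divr_gt0.
move/cvgrPdist_le: Hre => /(_ _ e2) Hre.
move/cvgrPdist_le: Him => /(_ _ e2) Him.
apply: filterS2 Hre Him => -[x y] /= Hx Hy.
apply: le_trans (norm_le_Re_Im _) _; rewrite lecR/= [e']splitr.
exact: lerD.
Qed.

End ComplexScalars.

Definition scalar_embedding (R : realType) (c : ground) :
    real_embedding R (scalars R c) :=
  match c with
  | RealCase => id_embedding R
  | ComplexCase => complex_embedding R
  end.

Lemma convex_set_segment (R : realType) (K : numFieldType)
    (iota : real_embedding R K) n (D : set 'cV[K]_n) :
  convex_set D -> segment_convex iota D.
Proof.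
move=> cD x y t Dx Dy t01; have [t0 t1] := emb_itv01 iota t01.
have := cD y x (Itv01 t0 t1) (mem_set Dy) (mem_set Dx) => /set_mem.
suff -> : x + iota t *: (y - x) =
  conv (Itv01 t0 t1) (y : convex_lmodType 'cV[K]_n) x by [].
rewrite /conv/= /unstable.onem scalerBl scale1r scalerBr.
by rewrite addrCA.
Qed.

Lemma partial_lincomb (K : numFieldType) n D (k : 'I_n -> K) (f : 'I_n -> 'cV[K]_n -> K) i x :
    (forall j, smooth_on D (f j)) -> D x ->
  partial i (fun x => \sum_j k j * f j x) x = \sum_j k j * partial i (f j) x.
Proof.
move=> sf Dx; rewrite /partial.
have -> : (fun x => \sum_j k j * f j x) = \sum_j (k j *: f j).
  by apply/funext => y; rewrite fct_sumE.
rewrite derive_sum; last by move=> j; apply: derivableZ; have [] := sf j [::] x Dx.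
by apply: eq_bigr => j _; rewrite deriveZ//; have [] := sf j [::] x Dx.
Qed.

(** The Jacobian of B grad f is B H B^T with H the Hessian of g, which is
    symmetric by Schwarz's theorem. *)
Lemma smooth_next (R : realType) n D (B : 'M[R]_n) (f g : 'cV[R]_n -> R) :
    open D -> segment_convex (id_embedding R) D ->
    smooth_on D f -> smooth_on D g ->
    (forall x, D x -> grad f x = B *m grad g x) ->
  exists2 h, smooth_on D h & forall x, D x -> grad h x = B *m grad f x.
Proof.
move=> oD cD sf sg fBg.
pose F x := B *m grad f x.
have FE i : (fun x => F x i 0) = (fun x => \sum_j B i j * partial j f x).
  by apply/funext => x; rewrite mxE; apply: eq_bigr => j _; rewrite mxE.
have sF i : smooth_on D (fun x => F x i 0).
  rewrite FE; exact: (smooth_on_sum _ _ oD (fun j => smooth_on_partial j sf)).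
have second j k x : D x -> partial j (partial k f) x =
    \sum_l B j l * partial k (partial l g) x.
  move=> Dx; rewrite (smooth_schwarz (id_embedding R) j k oD sf Dx).
  rewrite -(partial_lincomb _ k (fun l => smooth_on_partial l sg) Dx).
  apply: near_eq_derive; apply: filterS (open_nbhs_nbhs (conj oD Dx)) => y Dy.
  have /matrixP/(_ j 0) := fBg y Dy; rewrite !mxE => ->.
  by apply: eq_bigr => l _; rewrite mxE.
have symF i j x : D x ->
    partial j (fun x => F x i 0) x = partial i (fun x => F x j 0) x.
  move=> Dx; have E p q : partial q (fun x => F x p 0) x =
      \sum_k \sum_l B p k * (B q l * partial k (partial l g) x).
    rewrite FE (partial_lincomb _ q (fun l => smooth_on_partial l sf) Dx).
    by apply: eq_bigr => k _; rewrite second// mulr_sumr.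
  rewrite !E exchange_big/=; apply: eq_bigr => l _; apply: eq_bigr => k _.
  by rewrite mulrCA (smooth_schwarz (id_embedding R) k l oD sg Dx).
have [h hF] : exists h, gradient_on D h F.
  apply: (glue_gradient (iota := id_embedding R)) => // a Da.
  exact: (local_primitive_real oD Da sF symF).
exists h; first exact: (smooth_on_primitive (id_embedding R) oD hF sF).
move=> x Dx; apply/colP => i; rewrite mxE.
by have [_ <-] := hF x Dx i.
Qed.

Lemma analytic_next (R : realType) n D (B : 'M[scalars R ComplexCase]_n)
    (f g : 'cV[scalars R ComplexCase]_n -> scalars R ComplexCase) :
    open D -> segment_convex (complex_embedding R) D ->
    analytic_on D f -> analytic_on D g ->
    (forall x, D x -> grad f x = B *m grad g x) ->
  exists2 h, analytic_on D h & forall x, D x -> grad h x = B *m grad f x.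
Proof.
move=> oD cD af ag fBg.
pose F x := B *m grad f x.
have loc x : D x -> exists2 r, 0 < r & exists2 P, analytic_at P x & gradient_on (ball x r) P F.
  move=> Dx.
  apply: (analytic_local_primitive (complex_embedding R) (@complex_complete R) (af x Dx) (ag x Dx)).
  have /nbhs_ballP[r /= r0 rD] := open_nbhs_nbhs (conj oD Dx).
  apply/near0P; exists r => // h hr; apply/fBg/rD.
  by rewrite -ball_normE/= opprD addrA subrr sub0r normrN.
have [h hF] : exists h, gradient_on D h F.
  apply: (glue_gradient (iota := complex_embedding R)) => // a Da.
  by have [r r0 [P _ PF]] := loc a Da; exists r => //; exists P.
exists h; last first.
  by move=> x Dx; apply/colP => i; rewrite mxE; have [_ <-] := hF x Dx i.
move=> x Dx; have [r r0 [P aP PF]] := loc x Dx.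
have oU : open (D `&` ball x r) by apply: openI => //; exact: ball_open.
have cU : segment_convex (complex_embedding R) (D `&` ball x r).
  by apply: segment_convexI => //; exact: segment_convex_ball.
have Ux : (D `&` ball x r) x by split => //; exact: ballxx.
apply: (@analytic_at_eq _ _ (fun y => P y + (h x - P x))); last exact: analytic_at_addc.
apply: filterS (open_nbhs_nbhs (conj oU Ux)) => y Uy.
have E := same_gradient oU cU (gradient_onS (@subIsetr _ _ _) PF)
  (gradient_onS (@subIsetl _ _ _) hF) Ux Uy.
by rewrite -E addrC subrK.
Qed.

Lemma regular_gradient (R : realType) c n (D : set 'cV[scalars R c]_n) f :
  regular_on D f -> gradient_on D f (grad f).
Proof.
case: c D f => D f /=; first exact: smooth_gradient.
exact: (analytic_gradient (complex_embedding R) (@complex_complete R)).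
Qed.

(** The integration step, which preserves the hypothesis on the pair of
    functions. *)
Lemma gradient_solution_next (R : realType) c n (D : set 'cV[scalars R c]_n)
    (B : 'M[scalars R c]_n) f g : open D -> convex_set D ->
  gradient_solution D B f g -> exists h, gradient_solution D B h f.
Proof.
move=> oD /(convex_set_segment (scalar_embedding R c)) cD [].
case: c D B f g oD cD => D B f g oD cD rf rg fBg.
  by have [h sh hE] := @smooth_next R n D B f g oD cD rf rg fBg; exists h.
by have [h sh hE] := @analytic_next R n D B f g oD cD rf rg fBg; exists h.
Qed.

(** * The coefficients in mu *)

Section Coefficients.
Context {K : numFieldType} {n : nat}.
Implicit Types (f g : 'cV[K]_n -> K) (B : 'M[K]_n).

Lemma dvd_Xn_coefP (p : {poly K}) r : 'X^r %| p <-> forall k, (k < r)%N -> p`_k = 0.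
Proof.
split=> [/dvdpP[q ->] k kr|H]; first by rewrite coefMXn kr.
rewrite -(poly_take_drop r p); have -> : take_poly r p = 0.
  by apply/polyP => k; rewrite coef_take_poly coef0; case: ifP => // /H.
by rewrite add0r dvdp_mull.
Qed.

(** The coefficient of mu^k of the product is grad V_(k-1) - B grad V_k. *)
Lemma A_mu_grad_muP B r (W : 'cV[K]_n -> {poly K}) x :
  (forall i, 'X^r %| (A_mu B *m grad_mu r W x) i 0) <->
  (forall k, (k < r)%N -> B *m grad (fun y => (W y)`_k) x =
    if k is k'.+1 then grad (fun y => (W y)`_k') x else 0).
Proof.
have E i k : (k < r)%N -> ((A_mu B *m grad_mu r W x) i 0)`_k =
   (if k is k'.+1 then grad (fun y => (W y)`_k') x else 0) i 0
   - (B *m grad (fun y => (W y)`_k) x) i 0.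
  have split_coef (M G : 'cV[{poly K}]_n) : ((- M + 'X *: G) i 0)`_k =
      (if k == 0%N then 0 else (G i 0)`_k.-1) - (M i 0)`_k.
    by rewrite !mxE coefD coefN coefXM addrC.
  move=> kr; rewrite mulmxDl mulNmx mul_scalar_mx split_coef; congr (_ - _).
    case: k kr {split_coef} => [|k] kr /=; first by rewrite mxE.
    by rewrite !mxE coef_poly ltnW.
  rewrite [in LHS]mxE [in RHS]mxE coef_sum; apply: eq_bigr => j _.
  by rewrite !mxE coefCM coef_poly kr.
split=> [H k kr|H i].
  apply/colP => i; apply/esym/eqP; rewrite -subr_eq0; apply/eqP.
  by rewrite -E//; have /dvd_Xn_coefP := H i; apply.
by apply/dvd_Xn_coefP => k kr; rewrite E// H// subrr.
Qed.

Lemma coef_V_mu r (V : 'I_(r - 2) -> 'cV[K]_n -> K) f g x : (2 <= r)%N ->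
  [/\ forall k : 'I_(r - 2), (V_mu V f g x)`_k = V k x,
      (V_mu V f g x)`_(r - 2) = f x & (V_mu V f g x)`_(r - 1) = g x].
Proof.
move=> r2.
have E k : (V_mu V f g x)`_k = (\sum_(j < r - 2) V j x * (k == j :> nat)%:R)
    + f x * (k == (r - 2)%N)%:R + g x * (k == (r - 1)%N)%:R.
  rewrite /V_mu !coefD !coefZ !coefXn coef_sum; congr (_ + _ + _).
  by apply: eq_bigr => j _; rewrite coefZ coefXn.
have r12 : (r - 1 = (r - 2).+1)%N by rewrite -subSn.
have big0 k : (r - 2 <= k)%N -> \sum_(j < r - 2) V j x * (k == j :> nat)%:R = 0.
  by move=> kr; rewrite big1// => j _; rewrite gtn_eqF ?mulr0// (leq_trans _ kr).
split=> [k||]; rewrite E.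
- rewrite (bigD1 k)//= eqxx mulr1 big1 ?addr0 => [|j jk].
    by rewrite !ltn_eqF ?mulr0 ?addr0// r12 ltnS ltnW.
  by rewrite eq_sym (inj_eq val_inj) (negPf jk) mulr0.
- by rewrite big0// eqxx mulr1 add0r ltn_eqF ?mulr0 ?addr0// r12.
- by rewrite big0 ?r12// eqxx mulr1 add0r gtn_eqF ?mulr0 ?add0r.
Qed.

End Coefficients.

Lemma gradient_chain (R : realType) c n (D : set 'cV[scalars R c]_n)
    (B : 'M[scalars R c]_n) f g : open D -> convex_set D ->
    gradient_solution D B f g ->
  exists W : nat -> 'cV[scalars R c]_n -> scalars R c,
    [/\ W 0%N = g, W 1%N = f & forall k, gradient_solution D B (W k.+1) (W k)].
Proof.
move=> oD cD fg.
pose T := ('cV[scalars R c]_n -> scalars R c)%type.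
have /choice[next Hnext] : forall p : T * T, exists h : T,
    gradient_solution D B p.1 p.2 -> gradient_solution D B h p.1.
  move=> [f1 g1]; have [s|ns] := pselect (gradient_solution D B f1 g1).
    by have [h Hh] := gradient_solution_next oD cD s; exists h.
  by exists g1.
pose S k := iter k (fun p : T * T => (next p, p.1)) (f, g).
exists (fun k => (S k).2); split=> // k /=.
by elim: k => [//|k IH] /=; apply: Hnext.
Qed.

Theorem proposition1 (R : realType) (c : ground) (n : nat)
    (D : set 'cV[scalars R c]_n) (B : 'M[scalars R c]_n) (r : nat)
    (openD : open D) (convexD : convex_set D)
    (nilB : nilpotent_mx B) (r_ge2 : (2 <= r)%N) (Br0 : B ^+ r = 0) :
  (forall (V : 'I_(r - 2) -> 'cV[scalars R c]_n -> scalars R c)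
          (f g : 'cV[scalars R c]_n -> scalars R c),
     extended_solution D B V f g -> gradient_solution D B f g) /\
  (forall f g : 'cV[scalars R c]_n -> scalars R c,
     gradient_solution D B f g ->
     exists V : 'I_(r - 2) -> 'cV[scalars R c]_n -> scalars R c,
       extended_solution D B V f g /\
       (forall V' : 'I_(r - 2) -> 'cV[scalars R c]_n -> scalars R c,
          extended_solution D B V' f g ->
          forall k, exists a : scalars R c,
            forall x, D x -> V' k x = V k x + a)).
Proof.
pose coefV (V : 'I_(r - 2) -> 'cV[scalars R c]_n -> scalars R c) f g k
  (x : 'cV[scalars R c]_n) : scalars R c := (V_mu V f g x)`_k.
have coefVk V f g (k : 'I_(r - 2)) : coefV V f g k = V k.
  by apply/funext => x; have [E _ _] := coef_V_mu V f g x r_ge2; exact: E.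
have coefVf V f g : coefV V f g (r - 2)%N = f.
  by apply/funext => x; have [] := coef_V_mu V f g x r_ge2.
have coefVg V f g : coefV V f g (r - 1)%N = g.
  by apply/funext => x; have [] := coef_V_mu V f g x r_ge2.
have r12 : (r - 1 = (r - 2).+1)%N by rewrite -subSn.
have chain V f g k x : extended_solution D B V f g -> D x -> (k.+1 < r)%N ->
    B *m grad (coefV V f g k.+1) x = grad (coefV V f g k) x.
  by move=> [_ _ _ VE] Dx kr; have /A_mu_grad_muP/(_ _ kr) := VE x Dx.
split=> [V f g sV|f g fg].
  case: (sV) => _ rf rg _; split=> // x Dx.
  have := chain V f g (r - 2)%N x sV Dx.
  rewrite -r12 coefVf coefVg => ->//.
  by rewrite subn1 prednK// ltnW.
have [W [W0 W1 HW]] := gradient_chain openD convexD fg.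
(* W starts from g, the coefficient of the highest power of mu. *)
pose V (k : 'I_(r - 2)) := W (r - 1 - k)%N.
have VW k : (k < r)%N -> coefV V f g k = W (r - 1 - k)%N.
  move=> kr; have [kr2|] := ltnP k (r - 2); first exact: (coefVk V f g (Ordinal kr2)).
  rewrite leq_eqVlt => /orP[/eqP <-|]; first by rewrite coefVf r12 subSnn W1.
  rewrite -r12 => rk; have -> : k = (r - 1)%N.
    by apply/eqP; rewrite eqn_leq rk andbT -ltnS subn1 prednK// ltnW.
  by rewrite coefVg subnn W0.
have gradW k x : D x -> grad (W k) x = B ^+ k *m grad g x.
  move=> Dx; elim: k => [|k IH]; first by rewrite expr0 mul1mx W0.
  have [_ _ ->//] := HW k.
  by rewrite IH exprS mulmxA.
have sV : extended_solution D B V f g.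
  case: fg => rf rg _; split=> // [k|x Dx].
    by rewrite /V; have [_ ? _] := HW (r - 1 - k)%N.
  apply/A_mu_grad_muP => k kr.
  rewrite -/(coefV V f g k) (VW k kr); have [_ _ <-//] := HW (r - 1 - k)%N.
  case: k kr => [|k] kr.
    by rewrite subn0 subn1 prednK ?(ltnW r_ge2)// gradW// Br0 mul0mx.
  rewrite -/(coefV V f g k) (VW k (ltnW kr)); congr (grad (W _) x).
  by rewrite subnSK// ltn_subRL add1n.
exists V; split=> // V' sV' k.
(* The gradients agree at the top, and the chain propagates this downwards. *)
have same j x : D x -> (j < r)%N ->
    grad (coefV V' f g (r - 1 - j)%N) x = grad (coefV V f g (r - 1 - j)%N) x.
  move=> Dx; elim: j => [|j IH] jr; first by rewrite subn0 !coefVg.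
  have j1 : (j < r - 1)%N by rewrite ltn_subRL add1n.
  have jS : (r - 1 - j = (r - 1 - j.+1).+1)%N by rewrite subnSK.
  have lt : ((r - 1 - j.+1).+1 < r)%N.
    by rewrite -jS (leq_ltn_trans (leq_subr _ _))// ltn_subrL/= (ltnW r_ge2).
  rewrite -(chain V' f g _ x sV' Dx lt) -(chain V f g _ x sV Dx lt) -jS IH//.
  exact: ltnW.
have gradVk x : D x -> grad (V' k) x = grad (V k) x.
  have kr : (k <= r - 1)%N by rewrite r12 ltnW// ltnS ltnW.
  move=> Dx; have := same (r - 1 - k)%N x Dx.
  rewrite subKn// !coefVk; apply.
  by rewrite (leq_ltn_trans (leq_subr _ _))// ltn_subrL/= (ltnW r_ge2).
have [rV _ _ _] := sV; have [rV' _ _ _] := sV'.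
have [[a Da]|noD] := pselect (exists a, D a); last first.
  by exists 0 => x Dx; case: noD; exists x.
exists (V' k a - V k a) => x Dx.
have dV' : gradient_on D (V' k) (grad (V k)).
  by move=> y Dy i; rewrite -(gradVk y Dy); apply: (regular_gradient (rV' k)).
have cD := convex_set_segment (scalar_embedding R c) convexD.
have <- := same_gradient openD cD (regular_gradient (rV k)) dV' Da Dx.
by rewrite addrC subrK.
Qed.
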